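(* Suppose $0\leqslant\lambda\leqslant\lambda_0$. There exists a unique probability measure $P_\lambda$ on $(\Omega,\Sigma)$ such that for any finite set $Q\subset\mathbb{Z}^\nu$ and any $A\in\Sigma_Q$: $P_\lambda(A)=P_{\lambda,Q}(A)$, where $P_{\lambda,Q}(A)=\lim_{N\to\infty}P_N(A)$.
   Context: Fix an integer $\nu\geqslant1$ and the lattice $\mathbb{Z}^\nu$ with the distance $\|\boldsymbol{s}-\boldsymbol{t}\|=\sum_{i=1}^\nu|s_i-t_i|$. For each $\boldsymbol{t}\in\mathbb{Z}^\nu$ let $P_{\boldsymbol{t}}$ be a given Borel probability measure on $\mathbb{R}$. Let $\Omega=\mathbb{R}^{\mathbb{Z}^\nu}$ (all functions $\omega:\mathbb{Z}^\nu\to\mathbb{R}$), $\Sigma$ the product $\sigma$-algebra generated by the sets $\{\omega:\omega(\boldsymbol{t})\in F\}$ ($\boldsymbol{t}\in\mathbb{Z}^\nu$, $F\subseteq\mathbb{R}$ Borel), and $P_0$ the product probability measure on $(\Omega,\Sigma)$ of the measures $P_{\boldsymbol{t}}$. $\langle\cdot\rangle_0$ denotes expectation with respect to $P_0$. For finite $B\subset\mathbb{Z}^\nu$, $\Sigma_B$ is the $\sigma$-algebra generated by the sets $\{\omega:\omega(\boldsymbol{t})\in F\}$ with $\boldsymbol{t}\in B$, $F$ Borel. A graph $(V,E)$ with $V$ a finite subset of $\mathbb{Z}^\nu$ (edges are pairs of distinct vertices) is called 1-connected if it is connected and every edge joins two points at distance 1. For a finite $B\subset\mathbb{Z}^\nu$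 with at least two elements, its size $S(B)$ is the minimum number of edges of 1-connected graphs $(V,E)$ with $B\subseteq V$. Fix a real number $r\geqslant1$ and let $\mathfrak{B}$ be the collection of finite sets $B\subset\mathbb{Z}^\nu$ with at least two elements and $1\leqslant S(B)\leqslant r$. Let $\lambda\geqslant0$ be real, and for each $B\in\mathfrak{B}$ let $\Phi_B$ be a $\Sigma_B$-measurable real random variable on $\Omega$ with $|\Phi_B|\leqslant\lambda$. For $N\in\mathbb{N}$ let $\Lambda_N=\{\boldsymbol{t}\in\mathbb{Z}^\nu: |t_i|\leqslant N,\ i=1,\dots,\nu\}$, $U_N=\sum_{B\in\mathfrak{B},\,B\subseteq\Lambda_N}\Phi_B$, and $P_N(A)=\dfrac{\langle I_A e^{U_N}\rangle_0}{\langle e^{U_N}\rangle_0}$ for $A\in\Sigma$, where $I_A$ is the indicator of $A$. For finite $Q\subset\mathbb{Z}^\nu$ and $A\in\Sigma_Q$ the limit defining $P_{\lambda,Q}(A)$ is over $N\in\mathbb{N}$ with $Q\subseteq\Lambda_N$; its existence for $0\leqslant\lambda\leqslant\lambda_0$ is part of what is asserted. For $B\in\mathfrak{B}$ let $l(B)$ be the number of sets $C\in\mathfrak{B}$ with $C\cap B\neq\varnothing$ (including $C=B$), and $L=\max\{l(B): B\in\mathfrak{B}\}$ (a finite number depending only on $\nu$ and $r$). Put $\lambda_0=\dfrac{1}{50L(8\nu)^{2r}}$. *)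

(* Defs.v *)
From HB Require Import structures.
From mathcomp Require Import all_boot all_order all_algebra finmap.
From mathcomp Require Import all_classical all_reals all_analysis.

Set Implicit Arguments.
Unset Strict Implicit.
Unset Printing Implicit Defensive.

Import Order.TTheory GRing.Theory Num.Theory.
Import numFieldNormedType.Exports.

Local Open Scope classical_set_scope.
Local Open Scope ring_scope.

Definition is_nat_min (A : set nat) (n : nat) : Prop :=
  A n /\ forall m, A m -> (n <= m)%N.

Definition is_nat_max (A : set nat) (n : nat) : Prop :=
  A n /\ forall m, A m -> (m <= n)%N.

(* The default 0 is only taken when A is empty, resp. empty or unbounded. *)
Definition nat_min (A : set nat) : nat := xget 0%N (is_nat_min A).
Definition nat_max (A : set nat) : nat := xget 0%N (is_nat_max A).

Section LatticeGraphs.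
Variable nu : nat.

Definition lattice := {ffun 'I_nu -> int}.

Definition dist1 (s t : lattice) : nat := (\sum_(i < nu) `|s i - t i|)%N.

(* Edges are unordered pairs, represented by the two-element set of their
   endpoints; [is_graph] forces the endpoints to be distinct, so E is simple. *)
Definition is_graph (V : {fset lattice}) (E : {fset {fset lattice}}) : Prop :=
  forall e, e \in E ->
    exists s t, [/\ s \in V, t \in V, s != t & e = [fset s; t]%fset].

Definition adjacent (E : {fset {fset lattice}}) : rel lattice :=
  fun s t => [fset s; t]%fset \in E.

Definition is_connected (V : {fset lattice}) (E : {fset {fset lattice}}) : Prop :=
  forall s t, s \in V -> t \in V ->
    exists p : seq lattice, path (adjacent E) s p /\ last s p = t.

Definition one_connected (V : {fset lattice}) (E : {fset {fset lattice}}) : Prop :=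
  [/\ is_graph V E, is_connected V E &
      forall s t, adjacent E s t -> dist1 s t = 1%N].

Definition lattice_size (B : {fset lattice}) : nat :=
  nat_min [set n | exists V E,
    [/\ one_connected V E, {subset B <= V} & n = #|` E|]].

Variables (R : realType) (r : R).

Definition frakB : set {fset lattice} :=
  [set B : {fset lattice} | [/\ (2 <= #|` B|)%N, (1 <= lattice_size B)%N & (lattice_size B)%:R <= r]].

(* [fset_set] returns the finite set underlying a finite classical set; the set
   of C below is finite because its members lie within distance r of B. *)
Definition degree (B : {fset lattice}) : nat :=
  #|` fset_set [set C | frakB C /\ (C `&` B)%fset != fset0]|.

Definition max_degree : nat := nat_max [set degree B | B in frakB].

Definition lambda0 : R :=
  (50 * max_degree%:R * (8 * nu%:R) `^ (2 * r))^-1.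

Definition box (N : nat) : set lattice :=
  [set t | forall i, (`|t i| <= N)%N].

End LatticeGraphs.

Section Configurations.
Variables (R : realType) (nu : nat).

Definition coordinate_sets (D : set (lattice nu)) :
    set (set (lattice nu -> R)) :=
  [set [set w | F (w t)] | t in D &
     F in (measurable : set (set (measurableTypeR R)))].

Definition Omega := g_sigma_algebraType (coordinate_sets [set: lattice nu]).

Definition Sigma_ (B : {fset lattice nu}) : set (set Omega) :=
  <<s coordinate_sets [set` B] >>.

Definition Sigma_measurable (B : {fset lattice nu}) (f : Omega -> R) : Prop :=
  @measurable_fun _ _ (g_sigma_algebraType (coordinate_sets [set` B]))
    (measurableTypeR R) setT f.

(* Infinite product measures are not in the library; this property determines
   P0 on the product sigma-algebra. *)
Definition is_product_probability
    (P : lattice nu -> probability (measurableTypeR R) R)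
    (P0 : probability Omega R) : Prop :=
  forall (B : {fset lattice nu})
         (F : lattice nu -> set (measurableTypeR R)),
    (forall t, t \in B -> measurable (F t)) ->
    P0 [set w | forall t, t \in B -> F t (w t)] =
    (\prod_(t <- B) P t (F t))%E.

Variables (r : R) (P0 : probability Omega R).
Variable Phi : {fset lattice nu} -> Omega -> R.

Definition U_ (N : nat) (w : Omega) : R :=
  \sum_(B \in [set B | frakB r B /\ [set` B] `<=` box N]) Phi B w.

Definition expect0 (X : Omega -> R) : R := fine ('E_P0[X]).

Definition P_ (N : nat) (A : set Omega) : R :=
  expect0 (fun w => \1_A w * expR (U_ N w)) / expect0 (fun w => expR (U_ N w)).

(* For A in Sigma_ Q this is the limit over the N such that Q is contained in
   box N: all large enough N are such. *)
Definition P_lim (A : set Omega) : R := limn (fun N => P_ N A).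

Definition extends_P_lim (P : probability Omega R) : Prop :=
  forall (Q : {fset lattice nu}) (A : set Omega),
    Sigma_ Q A -> P A = (P_lim A)%:E.

End Configurations.

(* Main.v *)
Require Import Defs.
From HB Require Import structures.
From mathcomp Require Import all_boot all_order all_algebra finmap.
From mathcomp Require Import all_classical all_reals all_analysis.
From mathcomp Require Import measurable_realfun zify ring lra.

Set Implicit Arguments.
Unset Strict Implicit.
Unset Printing Implicit Defensive.

Import Order.TTheory GRing.Theory Num.Theory.
Import numFieldNormedType.Exports.

Local Open Scope classical_set_scope.
Local Open Scope ring_scope.

(* Dobrushin's single-site argument replaces the cluster expansion.  Resampling
   one site [t] from its conditional law (a heat bath) does not change the Gibbs
   mean of a local function once the box contains every interaction touching
   [t]; it removes the oscillation at [t] and hands at most half of it over to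
   the neighbouring sites, because [lambda <= lambda0] makes the total influence
   of a site at most 1/2.  A sweep over the support of a local function thus
   halves its total oscillation, so the finite-volume means of a local function
   form a Cauchy sequence.

   Freezing the sites of a finite set [Q] multiplies the Boltzmann weight by a
   local function, so the unnormalised conditional expectations given [Q] also
   converge, for every frozen configuration.  With these limits as transition
   kernels the Ionescu-Tulcea argument shows that the limit content on local
   events is continuous at the empty set; Caratheodory's theorem extends it. *)

(** * Means of bounded measurable functions *)

Section BoundedMeasurable.
Context d (T : measurableType d) (R : realType).
Implicit Types f g : T -> R.

Definition bounded_measurable f :=
  measurable_fun setT f /\ exists M, forall x, `|f x| <= M.

Lemma bounded_measurable_cst (c : R) : bounded_measurable (fun=> c).
Proof. by split=> //; exists `|c|. Qed.

Lemma bounded_measurableD f g : bounded_measurable f -> bounded_measurable g ->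
  bounded_measurable (fun x => f x + g x).
Proof.
move=> [mf [M fM]] [mg [N gN]]; split; first exact: measurable_funD.
by exists (M + N) => x; rewrite (le_trans (ler_normD _ _))// lerD.
Qed.

Lemma bounded_measurableM f g : bounded_measurable f -> bounded_measurable g ->
  bounded_measurable (fun x => f x * g x).
Proof.
move=> [mf [M fM]] [mg [N gN]]; split; first exact: measurable_funM.
by exists (M * N) => x; rewrite normrM ler_pM.
Qed.

Lemma bounded_measurableN f : bounded_measurable f ->
  bounded_measurable (fun x => - f x).
Proof.
by move=> [mf [M fM]]; split; [exact: measurable_funN|exists M => x; rewrite normrN].
Qed.

Lemma bounded_measurableB f g : bounded_measurable f -> bounded_measurable g ->
  bounded_measurable (fun x => f x - g x).
Proof. by move=> bf bg; apply/bounded_measurableD/bounded_measurableN. Qed.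

Lemma bounded_measurable_norm f : bounded_measurable f ->
  bounded_measurable (fun x => `|f x|).
Proof.
move=> [mf [M fM]]; split; first exact: measurableT_comp.
by exists M => x; rewrite normr_id.
Qed.

Lemma bounded_measurable_sum (I : eqType) (s : seq I) (F : I -> T -> R) :
  (forall i, i \in s -> bounded_measurable (F i)) ->
  bounded_measurable (fun x => \sum_(i <- s) F i x).
Proof.
elim: s => [_|i s ih bF].
  by under eq_fun do rewrite big_nil; exact: bounded_measurable_cst.
under eq_fun do rewrite big_cons; apply: bounded_measurableD.
  by apply: bF; rewrite mem_head.
by apply: ih => j js; apply: bF; rewrite in_cons js orbT.
Qed.

Lemma bounded_measurable_expR f : bounded_measurable f ->
  bounded_measurable (fun x => expR (f x)).
Proof.
move=> [mf [M fM]]; split; first exact: measurableT_comp.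
exists (expR M) => x; rewrite ger0_norm ?expR_ge0// ler_expR.
exact: le_trans (ler_norm _) (fM x).
Qed.

Lemma bounded_measurable_indic (A : set T) : measurable A ->
  bounded_measurable (\1_A : T -> R).
Proof.
move=> mA; split; first exact: measurable_indic.
exists 1 => x; rewrite indicE.
by case: (x \in A); rewrite ?normr1 ?normr0.
Qed.

Variable P : probability T R.

Lemma bounded_measurable_integrable f : bounded_measurable f ->
  P.-integrable setT (EFin \o f).
Proof.
move=> [mf [M fM]]; apply: measurable_bounded_integrable => //.
  by rewrite (le_lt_trans (probability_le1 P measurableT))// ltry.
exists M; split; first by rewrite num_real.
by move=> x /ltW Mx y _; exact: le_trans (fM y) Mx.
Qed.
Local Notation int := bounded_measurable_integrable.

Lemma mean_cst (c : R) : \int[P]_x c = c.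
Proof.
rewrite Rintegral_cst//; have := probability_setT P.
by rewrite /= => -> /=; rewrite mulr1.
Qed.

Lemma meanD f g : bounded_measurable f -> bounded_measurable g ->
  \int[P]_x (f x + g x) = \int[P]_x f x + \int[P]_x g x.
Proof. by move=> /int ? /int ?; exact: RintegralD. Qed.

Lemma meanB f g : bounded_measurable f -> bounded_measurable g ->
  \int[P]_x (f x - g x) = \int[P]_x f x - \int[P]_x g x.
Proof. by move=> /int ? /int ?; exact: RintegralB. Qed.

Lemma meanZ (c : R) f : bounded_measurable f ->
  \int[P]_x (c * f x) = c * \int[P]_x f x.
Proof. by move=> /int ?; exact: RintegralZl. Qed.

Lemma le_mean f g : bounded_measurable f -> bounded_measurable g ->
  (forall x, f x <= g x) -> \int[P]_x f x <= \int[P]_x g x.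
Proof. by move=> /int ? /int ? fg; apply: le_Rintegral. Qed.

Lemma mean_le f (c : R) : bounded_measurable f -> (forall x, f x <= c) ->
  \int[P]_x f x <= c.
Proof.
move=> bf fc; rewrite -[leRHS]mean_cst; apply: le_mean => //.
exact: bounded_measurable_cst.
Qed.

Lemma mean_ge f (c : R) : bounded_measurable f -> (forall x, c <= f x) ->
  c <= \int[P]_x f x.
Proof.
move=> bf fc; rewrite -[leLHS]mean_cst; apply: le_mean => //.
exact: bounded_measurable_cst.
Qed.

Lemma mean_norm f : bounded_measurable f ->
  `|\int[P]_x f x| <= \int[P]_x `|f x|.
Proof. by move=> /int ?; exact: le_normr_Rintegral. Qed.

Lemma mean_norm_le f (c : R) : bounded_measurable f ->
  (forall x, `|f x| <= c) -> `|\int[P]_x f x| <= c.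
Proof.
move=> bf fc; apply: le_trans (mean_norm bf) _.
by apply: mean_le => //; exact: bounded_measurable_norm.
Qed.

Lemma mean_expR_gt0 f : bounded_measurable f -> 0 < \int[P]_x expR (f x).
Proof.
move=> bf; have [_ [M fM]] := bf; apply: (lt_le_trans (expR_gt0 (- M))).
apply: mean_ge; first exact: bounded_measurable_expR.
by move=> x; rewrite ler_expR; have := fM x; rewrite ler_norml => /andP[].
Qed.

Lemma eq_mean f g : f =1 g -> \int[P]_x f x = \int[P]_x g x.
Proof. by move=> fg; apply: eq_Rintegral => x _. Qed.

Lemma EFin_mean f : bounded_measurable f ->
  (\int[P]_x f x)%:E = (\int[P]_x (f x)%:E)%E.
Proof. by move=> /int ?; rewrite fineK//; exact: integrable_fin_num. Qed.

(** Dominated convergence applied to the sequence shifted by [N]: the bound may start late because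
    finite-volume estimates hold only for large boxes. *)
Lemma mean_dominated_cvg (f_ : nat -> T -> R) f (M : R) :
  (forall n, measurable_fun setT (f_ n)) ->
  (\forall n \near \oo, forall x, `|f_ n x| <= M) ->
  (forall x, f_ n x @[n --> \oo] --> f x) ->
  bounded_measurable f /\
  \int[P]_x f_ n x @[n --> \oo] --> \int[P]_x f x.
Proof.
move=> mf_ [N _ fM] f_f.
have mf : measurable_fun setT f by apply: (measurable_fun_cvg mf_) => x _.
have fM' x : `|f x| <= M.
  have fx : `|f_ n x| @[n --> \oo] --> `|f x| by apply: cvg_norm.
  rewrite -(cvg_lim (@Rhausdorff R) fx); apply: limr_le.
    by apply/cvg_ex; eexists; exact: fx.
  by exists N => // n Nn; exact: fM.
have bf : bounded_measurable f by split=> //; exists M.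
split=> //; rewrite -(cvg_shiftn N).
have bf_ n : bounded_measurable (f_ (n + N)%N).
  by split=> //; exists M; apply: fM => /=; exact: leq_addl.
apply: fine_cvg.
rewrite fineK; last by apply: integrable_fin_num => //; exact: int.
have [//|//|||//|_ _ +] := @dominated_convergence _ T R P setT measurableT
  (fun n x => (f_ (n + N)%N x)%:E) (EFin \o f) (cst M%:E).
- by move=> n; exact/measurable_EFinP.
- exact/measurable_EFinP.
- apply: aeW => x _; apply: cvg_EFin; first exact: nearW.
  by rewrite (cvg_shiftn N (f_ ^~ x)).
- by apply: int; exact: bounded_measurable_cst.
- by apply: aeW => x n _ /=; rewrite lee_fin; apply: fM => /=; exact: leq_addl.
exact.
Qed.

(** Both quotients are integrals against probability densities [q] and [q'] whose ratio lies between
    [expR (- (2 * k))] and [expR (2 * k)]: one factor [expR k] comes from the weight, one from the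
    normalisation. Changing the integrand costs [a]. Changing the density costs [expR (2 * k) - 1]
    times the deviation of [h'] from [m], since a constant has the same integral against both
    densities. *)
Lemma tilted_mean_diff (u u' h h' : T -> R) (k a b m : R) :
  bounded_measurable u -> bounded_measurable u' ->
  bounded_measurable h -> bounded_measurable h' ->
  (forall x, `|u x - u' x| <= k) ->
  (forall x, `|h x - h' x| <= a) -> (forall x, `|h' x - m| <= b) ->
  `|(\int[P]_x (h x * expR (u x))) / (\int[P]_x expR (u x)) -
    (\int[P]_x (h' x * expR (u' x))) / (\int[P]_x expR (u' x))| <=
  a + (expR (2 * k) - 1) * b.
Proof.
move=> bu bu' bh bh' uk ha hb.
have beu := bounded_measurable_expR bu.
have beu' := bounded_measurable_expR bu'.
have Z_gt0 := mean_expR_gt0 bu; have Z'_gt0 := mean_expR_gt0 bu'.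
set Z := \int[P]_x expR (u x) in Z_gt0 *.
set Z' := \int[P]_x expR (u' x) in Z'_gt0 *.
pose q x := Z^-1 * expR (u x); pose q' x := Z'^-1 * expR (u' x).
have bq : bounded_measurable q.
  by apply: bounded_measurableM => //; exact: bounded_measurable_cst.
have bq' : bounded_measurable q'.
  by apply: bounded_measurableM => //; exact: bounded_measurable_cst.
have q1 : \int[P]_x q x = 1 by rewrite meanZ// mulVf// gt_eqF.
have q'1 : \int[P]_x q' x = 1 by rewrite meanZ// mulVf// gt_eqF.
have q_ge0 x : 0 <= q x by rewrite mulr_ge0 ?invr_ge0 ?expR_ge0// ltW.
have q'_ge0 x : 0 <= q' x by rewrite mulr_ge0 ?invr_ge0 ?expR_ge0// ltW.
have eu x : expR (u x) <= expR k * expR (u' x) /\ expR (u' x) <= expR k * expR (u x).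
  have := uk x; rewrite ler_norml => /andP[u1 u2].
  by split; rewrite -expRD ler_expR; clear -u1 u2; lra.
have ZZ' : Z <= expR k * Z'.
  rewrite -meanZ//; apply: le_mean => //; last by move=> x; have [] := eu x.
  by apply: bounded_measurableM => //; exact: bounded_measurable_cst.
have Z'Z : Z' <= expR k * Z.
  rewrite -meanZ//; apply: le_mean => //; last by move=> x; have [] := eu x.
  by apply: bounded_measurableM => //; exact: bounded_measurable_cst.
pose K := expR (2 * k).
have KE : K = expR k * expR k by rewrite -expRD -mulr2n -mulr_natl.
have inv_le (y z : R) : 0 < y -> 0 < z -> z <= expR k * y ->
    y^-1 <= expR k * z^-1.
  by move=> y0 z0 zy; rewrite ler_pdivlMr// mulrC ler_pdivrMr.
have qq' x : q x <= K * q' x.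
  rewrite /q /q' KE mulrACA; apply: ler_pM.
  - by rewrite invr_ge0 ltW.
  - exact: expR_ge0.
  - exact: inv_le.
  - by have [] := eu x.
have q'q x : q' x <= K * q x.
  rewrite /q /q' KE mulrACA; apply: ler_pM.
  - by rewrite invr_ge0 ltW.
  - exact: expR_ge0.
  - exact: inv_le.
  - by have [] := eu x.
have K_gt0 : 0 < K by exact: expR_gt0.
have qB x : `|q x - q' x| <= (K - 1) * q' x.
  rewrite ler_norml; have := qq' x; have := q'q x; have := q'_ge0 x.
  set y := q x; set z := q' x => z0 zy yz.
  have Kz : K^-1 * z <= y by rewrite ler_pdivrMl.
  (* The lower ratio bound gives a relative deviation [1 - K^-1], which is at most [K - 1] because
     [K + K^-1 >= 2]. *)
  have KV : 2 - K^-1 <= K.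
    have : 0 <= (K - 1) ^+ 2 / K by rewrite divr_ge0 ?sqr_ge0// ltW.
    have -> : (K - 1) ^+ 2 / K = K - 2 + K^-1.
      by field; rewrite gt_eqF.
    by clear; lra.
  have := ler_wpM2r z0 KV; rewrite mulrBl => Kz'.
  by clear -Kz Kz' yz z0; apply/andP; split; lra.
have -> : (\int[P]_x (h x * expR (u x))) / Z = \int[P]_x (h x * q x).
  rewrite mulrC -meanZ; last exact: bounded_measurableM.
  by apply: eq_mean => x; rewrite /q mulrCA.
have -> : (\int[P]_x (h' x * expR (u' x))) / Z' = \int[P]_x (h' x * q' x).
  rewrite mulrC -meanZ; last exact: bounded_measurableM.
  by apply: eq_mean => x; rewrite /q' mulrCA.
have bm := bounded_measurable_cst m.
have bhq := bounded_measurableM bh bq.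
have bh'q := bounded_measurableM bh' bq.
have bh'q' := bounded_measurableM bh' bq'.
have bhh' := bounded_measurableB bh bh'.
have bqq' := bounded_measurableB bq bq'.
have bh'm := bounded_measurableB bh' bm.
have bmqq' := bounded_measurableM bm bqq'.
have bhh'q := bounded_measurableM bhh' bq.
have bh'mqq' := bounded_measurableM bh'm bqq'.
have -> : \int[P]_x (h x * q x) - \int[P]_x (h' x * q' x) =
    \int[P]_x ((h x - h' x) * q x) + \int[P]_x ((h' x - m) * (q x - q' x)).
  have -> : \int[P]_x ((h x - h' x) * q x) =
      \int[P]_x (h x * q x) - \int[P]_x (h' x * q x).
    by rewrite -meanB//; apply: eq_mean => x; rewrite mulrBl.
  have -> : \int[P]_x ((h' x - m) * (q x - q' x)) =
      (\int[P]_x (h' x * q x) - \int[P]_x (h' x * q' x)) -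
      m * (\int[P]_x q x - \int[P]_x q' x).
    rewrite -(meanB bh'q bh'q') -(meanB bq bq') -(meanZ m bqq').
    rewrite -(meanB (bounded_measurableB bh'q bh'q') bmqq').
    by apply: eq_mean => x; rewrite mulrBl mulrBr.
  by rewrite q1 q'1 subrr mulr0 subr0 addrA subrK.
apply: le_trans (ler_normD _ _) (lerD _ _).
  apply: le_trans (mean_norm bhh'q) _.
  have -> : a = \int[P]_x (a * q x) by rewrite meanZ// q1 mulr1.
  apply: le_mean => [||x].
  - exact: bounded_measurable_norm.
  - by apply: bounded_measurableM => //; exact: bounded_measurable_cst.
  - by rewrite normrM (ger0_norm (q_ge0 x)) ler_wpM2r.
apply: le_trans (mean_norm bh'mqq') _.
have -> : (K - 1) * b = \int[P]_x (b * (K - 1) * q' x).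
  by rewrite meanZ// q'1 mulr1 mulrC.
apply: le_mean => [||x].
- exact: bounded_measurable_norm.
- by apply: bounded_measurableM => //; exact: bounded_measurable_cst.
- by rewrite normrM -mulrA ler_pM.
Qed.

End BoundedMeasurable.

(** * Splicing of configurations, cylinders and resampling *)

Section Glue.
Variables (R : realType) (nu : nat).
Local Notation L := (lattice nu).
Local Notation Om := (Omega R nu).

(** The codomain is arbitrary so that [X := Prop] covers events as well as observables. *)
Definition depends_on (X : Type) (D : {pred L}) (f : Om -> X) :=
  forall w w' : Om, {in D, forall t, w t = w' t} -> f w = f w'.

Definition splice (D : {pred L}) (w w' : Om) : Om :=
  fun t => if t \in D then w' t else w t.

Lemma measurable_coordinate (t : L) :
  measurable_fun setT (fun w : Om => w t : measurableTypeR R).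
Proof.
move=> _ F mF; rewrite setTI; apply: sub_sigma_algebra.
by exists t => //; exists F.
Qed.

Lemma measurable_configuration d (T : measurableType d) (f : T -> Om) :
  (forall t, measurable_fun setT (fun x => f x t : measurableTypeR R)) ->
  measurable_fun setT f.
Proof.
move=> mf; apply: (@measurability _ _ _ _ _ f (coordinate_sets setT)) => //.
move=> _ [_ [t _ [F mF <-]] <-].
exact: (mf t measurableT F mF).
Qed.

Lemma measurable_splice_pair (D : {pred L}) :
  measurable_fun setT (fun p : Om * Om => splice D p.1 p.2).
Proof.
apply: measurable_configuration => t; rewrite /splice.
case: (t \in D); apply: (measurableT_comp (measurable_coordinate t)).
  exact: measurable_snd.
exact: measurable_fst.
Qed.

Lemma measurable_splice (D : {pred L}) (w : Om) : measurable_fun setT (splice D w).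
Proof.
apply: measurable_configuration => t; rewrite /splice.
case: (t \in D); first exact: measurable_coordinate.
exact: measurable_cst.
Qed.

Definition cylinder (B : {fset L}) (F : L -> set (measurableTypeR R)) : set Om :=
  [set w | forall t, t \in B -> F t (w t)].

Definition cylinders : set (set Om) :=
  [set cylinder BF.1 BF.2 | BF in
     [set BF : {fset L} * (L -> set (measurableTypeR R)) |
        forall t, measurable (BF.2 t)]].

Lemma Sigma_cylinder B F : (forall t, measurable (F t)) ->
  Sigma_ B (cylinder B F).
Proof.
move=> mF.
have -> : cylinder B F = (\bigcap_(t in [set` B]) [set w : Om | F t (w t)])%classic.
  by apply/seteqP; split => w /= Bw t; exact: Bw.
have := @fin_bigcap_measurable _ (g_sigma_algebraType (coordinate_sets [set` B]))
  _ [set` B] (fun t => [set w : Om | F t (w t)]).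
apply => // t Bt; apply: sub_sigma_algebra.
by exists t => //; exists (F t).
Qed.

Lemma Sigma_measurable_set B : Sigma_ B `<=` (measurable : set (set Om)).
Proof.
apply: smallest_sub; first exact: smallest_sigma_algebra.
move=> _ [t _ [F mF <-]].
by apply: sub_sigma_algebra; exists t => //; exists F.
Qed.

Lemma measurable_cylinder B F : (forall t, measurable (F t)) ->
  measurable (cylinder B F).
Proof. by move=> mF; exact: Sigma_measurable_set (Sigma_cylinder mF). Qed.

(** The sets that do not separate configurations agreeing on [B] form a sigma-algebra containing the
    generators of [Sigma_ B]. *)
Lemma Sigma_depends_on (B : {fset L}) (A : set Om) : Sigma_ B A ->
  depends_on (mem B) A.
Proof.
move=> BA.
have : [set A : set Om | depends_on (mem B) A] A; last by [].
move: A BA; apply: smallest_sub.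
  split=> /=.
  - by [].
  - by move=> A dA w w' ww'; rewrite setTD /setC/= (dA w w').
  - move=> F dF w w' ww'; apply/propext; split=> -[i _ Fi]; exists i => //.
      by rewrite -(dF i w w').
    by rewrite (dF i w w').
by move=> _ [t tB [F mF <-]] w w' ww' /=; rewrite ww'.
Qed.

Lemma generated_by_cylinders : (measurable : set (set Om)) = <<s cylinders >>.
Proof.
apply/seteqP; split.
  apply: smallest_sub; first exact: smallest_sigma_algebra.
  move=> _ [t _ [F mF <-]].
  apply: sub_sigma_algebra; exists ([fset t]%fset, fun=> F) => //.
  apply/seteqP; split=> [w /(_ t) /=|w Fw s]; first by rewrite inE eqxx; exact.
  by rewrite /= inE => /eqP ->.
apply: smallest_sub; first exact: smallest_sigma_algebra.
by move=> _ [[B F] mF <-]; exact: measurable_cylinder.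
Qed.

Lemma cylinders_setI : setI_closed cylinders.
Proof.
move=> _ _ [[B F] /= mF <-] [[C G] /= mG <-].
pose H t := (if t \in B then F t else setT) `&` (if t \in C then G t else setT).
exists ((B `|` C)%fset, H) => /=.
  by move=> t; apply: measurableI; case: ifP.
apply/seteqP; split => w /= => [Hw|[Bw Cw] t].
  split=> t tB.
    by have [] := Hw t; rewrite ?inE ?tB.
  by have [] := Hw t; rewrite ?inE ?tB ?orbT.
rewrite inE /H => tBC; split; first by case: ifP => // /Bw.
by case: ifP => // /Cw.
Qed.

(** Uniqueness on a pi-system: cylinders are stable under intersection, generate the sigma-algebra
    and include the whole space. *)
Lemma measure_eq_cylinders (m1 m2 : {measure set Om -> \bar R}) :
  (m1 setT < +oo)%E -> (forall A, cylinders A -> m1 A = m2 A) ->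
  forall A, measurable A -> m1 A = m2 A.
Proof.
move=> m1oo m12 A; apply: (measure_unique cylinders (fun=> setT)) => //.
- exact: generated_by_cylinders.
- exact: cylinders_setI.
- move=> _; exists (fset0, fun=> setT); first by move=> t; exact: measurableT.
  by apply/seteqP; split=> [w _|w _ t]; rewrite ?inE.
- exact: bigcup_const.
Qed.

Section ProductProbability.
Variables (P : L -> probability (measurableTypeR R) R) (P0 : probability Om R).
Hypothesis P0_prod : is_product_probability P P0.

Let P0_cylinder B F : (forall t, measurable (F t)) ->
  P0 (cylinder B F) = (\prod_(t <- B) P t (F t))%E.
Proof. by move=> mF; exact: P0_prod. Qed.

(** Independence of the sites: the preimage of a cylinder is a rectangle, with the constraints at
    sites of [D] on the second copy and the others on the first, so the product of site
    probabilities is recovered. *)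
Lemma splice_invariant (D : {pred L}) (A : set Om) : measurable A ->
  (P0 \x P0)%E ((fun p => splice D p.1 p.2) @^-1` A) = P0 A.
Proof.
move=> mA.
pose g (p : Om * Om) := splice D p.1 p.2.
have mg : measurable_fun setT g := measurable_splice_pair D.
pose mu0 : {measure set Om -> \bar R} := pushforward (P0 \x P0)%E g.
pose mu := mu0 mg.
have <- : mu A = P0 A; last by [].
apply: measure_eq_cylinders => // [|_ [[B F] /= mF <-]].
  rewrite /mu/= /pushforward preimage_setT.
  by rewrite (le_lt_trans (probability_le1 _ _)) ?ltry.
pose F1 t := if t \in D then setT else F t.
pose F2 t := if t \in D then F t else setT.
have mF1 t : measurable (F1 t) by rewrite /F1; case: ifP.
have mF2 t : measurable (F2 t) by rewrite /F2; case: ifP.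
have -> : mu (cylinder B F) =
    (P0 \x P0)%E (cylinder B F1 `*` cylinder B F2).
  rewrite /mu /= /pushforward; congr (_ _).
  apply/seteqP; split=> -[w w'] /= => [gF|[gF1 gF2] t tB].
    by split=> t tB; have := gF t tB; rewrite /F1 /F2 /g /splice;
      case: ifP => // _ _; exact: I.
  by have := gF1 t tB; have := gF2 t tB; rewrite /F1 /F2 /g /splice/=; case: ifP.
rewrite product_measure1E; [|exact: measurable_cylinder..].
rewrite [RHS]P0_cylinder//.
apply: etrans (congr2 mule (P0_cylinder B mF1) (P0_cylinder B mF2)) _.
rewrite -big_split/=; apply: eq_bigr => t _.
by rewrite /F1 /F2; case: ifP => _; rewrite probability_setT ?mul1e ?mule1.
Qed.

(** For a product measure this is the conditional expectation of [f] given the configuration outside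
    [D]. *)
Definition resample (D : {pred L}) (f : Om -> R) (w : Om) : R :=
  \int[P0]_w' f (splice D w w').

Lemma bounded_measurable_splice D w (f : Om -> R) : bounded_measurable f ->
  bounded_measurable (fun w' => f (splice D w w')).
Proof.
move=> [mf [M fM]]; split; last by exists M.
exact: (measurableT_comp mf (measurable_splice D w)).
Qed.

(** By Fubini the iterated integral is one over two independent configurations, whose splice again
    has law [P0]. *)
Lemma mean_resample D (f : Om -> R) : bounded_measurable f ->
  bounded_measurable (resample D f) /\
  \int[P0]_w resample D f w = \int[P0]_w f w.
Proof.
move=> bf; have [mf [M fM]] := bf.
pose g (p : Om * Om) := splice D p.1 p.2.
have mg : measurable_fun setT g := measurable_splice_pair D.
pose h (p : Om * Om) := (f (g p))%:E.
have bfg : bounded_measurable (f \o g).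
  by split; [exact: measurableT_comp|exists M => p; exact: fM].
have ih : (P0 \x P0)%E.-integrable setT h.
  exact: (bounded_measurable_integrable (P0 \x P0)%E bfg).
have hE w : (\int[P0]_w' h (w, w'))%E = (resample D f w)%:E.
  by rewrite /resample EFin_mean//; exact: bounded_measurable_splice.
have bI : bounded_measurable (resample D f).
  split.
    apply/measurable_EFinP; have := measurable_fubini_F ih.
    by congr (measurable_fun _ _); apply/funext => w; exact: hE.
  exists M => w; apply: mean_norm_le => [|w']; last exact: fM.
  exact: bounded_measurable_splice.
split=> //; apply/EFin_inj.
rewrite !EFin_mean// -(eq_integral _ _ (fun w _ => hE w)).
rewrite integral12_prod_meas1//.
pose mu0 : {measure set Om -> \bar R} := pushforward (P0 \x P0)%E g.
pose mu := mu0 mg.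
transitivity (\int[mu]_w (f w)%:E)%E.
  rewrite integral_pushforward//; exact/measurable_EFinP.
apply: eq_measure_integral => A mA _; exact: splice_invariant.
Qed.

Lemma resampleM D (f g : Om -> R) w : depends_on [predC D] g ->
  bounded_measurable f ->
  resample D (fun w' => g w' * f w') w = g w * resample D f w.
Proof.
move=> dg bf; rewrite /resample -meanZ; last exact: bounded_measurable_splice.
apply: eq_mean => w'; congr (_ * _); apply: dg => t /negbTE tD.
by rewrite /splice tD.
Qed.

Lemma depends_on_resample D f (C : {pred L}) : depends_on C f ->
  depends_on [predD C & D] (resample D f).
Proof.
move=> df w1 w2 w12; apply: eq_mean => w'; apply: df => t tC.
by rewrite /splice; case: ifPn => // tD; apply: w12; rewrite inE /= tD.
Qed.

(** The tower property: with the sites outside [E] frozen, it is [mean_resample] for the function of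
    the remaining sites. *)
Lemma resample_resample (D E : {pred L}) (f : Om -> R) w : {subset D <= E} ->
  bounded_measurable f ->
  resample E (resample D f) w = resample E f w.
Proof.
move=> DE bf.
have := (mean_resample D (bounded_measurable_splice E w bf)).2.
rewrite -/(resample E f w) => <-; apply: eq_mean => w1.
apply: eq_mean => w2; congr f; apply/funext => t; rewrite /splice.
by case: ifP => // /DE ->.
Qed.

End ProductProbability.

End Glue.

(** * Diameter, cardinality and counting of interaction sets *)

Section Combinatorics.
Variable nu : nat.
Local Notation L := (lattice nu).
Implicit Types (s t : L) (B V : {fset L}) (E : {fset {fset L}}).

Lemma finite_ball t (M : nat) :
  finite_set [set s : L | forall i, (`|s i - t i| <= M)%N].
Proof.
pose f (k : {ffun 'I_nu -> 'I_((M + M).+1)}) : L :=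
  [ffun i => (t i + (k i)%:Z - M%:Z)].
apply: (@sub_finite_set _ _ (f @` setT)); last exact/finite_image/finite_finset.
move=> s /= st.
exists [ffun i => inord (`|(s i - t i + M%:Z)%R|%N)] => //.
apply/ffunP => i; rewrite !ffunE; have := st i => sti.
move: (s i) (t i) sti => a b ab.
rewrite inordK; lia.
Qed.

Lemma finite_box N : finite_set (@box nu N).
Proof.
apply: sub_finite_set (finite_ball 0 N) => t /= tN i.
by rewrite ffunE subr0.
Qed.

Lemma dist1_triangle s t u : (dist1 s u <= dist1 s t + dist1 t u)%N.
Proof.
rewrite /dist1 -big_split/=; apply: leq_sum => i _; lia.
Qed.

Lemma coordinate_le_dist1 s t i : (`|s i - t i| <= dist1 s t)%N.
Proof. by rewrite /dist1 (bigD1 i)//= leq_addr. Qed.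

Lemma card_bigcup_le (l : seq {fset L}) :
  (#|` (\bigcup_(e <- l) e)%fset| <= \sum_(e <- l) #|` e|)%N.
Proof.
elim: l => [|e l ih]; first by rewrite !big_nil cardfs0.
rewrite !big_cons (leq_trans (leq_card_fsetU _ _))//.
by rewrite leq_add2l.
Qed.

(* Every vertex is an endpoint of some edge. The sharp bound [#|E| + 1] is not
   needed, thanks to the slack in [lambda0]. *)
Lemma one_connected_card V E : one_connected V E -> (2 <= #|` V|)%N ->
  (#|` V| <= 2 * #|` E|)%N.
Proof.
move=> [gE cE _] V2.
(* A path from [v] to a second vertex begins with an edge at [v]. *)
have VE : (V `<=` \bigcup_(e <- E) e)%fset.
  apply/fsubsetP => v vV.
  have : (0 < #|` (V `\ v)%fset|)%N by rewrite (cardfsD1 v V) vV in V2.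
  rewrite cardfs_gt0 => /fset0Pn[s]; rewrite !inE => /andP[sv sV].
  have [[|x p] [/= +]] := cE v s vV sV.
    by move=> _ /eqP; rewrite eq_sym (negbTE sv).
  move=> /andP[vx _] _; apply/bigfcupP.
  exists [fset v; x]%fset; last by rewrite !inE eqxx.
  by rewrite andbT.
apply: leq_trans (fsubset_leq_card VE) _.
apply: leq_trans (card_bigcup_le _) _.
rewrite -sum1_size big_distrr/= big_seq [leqRHS]big_seq; apply: leq_sum => e eE.
have [s [t [_ _ st ->]]] := gE e eE.
by rewrite cardfs2 st.
Qed.

(** A repetition-free path stays in [V], so it has fewer steps than [V] has points, and each step
    covers distance 1. *)
Lemma one_connected_dist1 V E s t : one_connected V E -> (2 <= #|` V|)%N ->
  s \in V -> t \in V -> (dist1 s t <= 2 * #|` E|)%N.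
Proof.
move=> ocE V2 sV tV; apply: leq_trans (one_connected_card ocE V2).
have [gE cE dE] := ocE.
have [p [pth <-{t tV}]] := cE s t sV tV.
case/shortenP: pth => {}p pth up _.
apply: (@leq_trans (size p)).
  elim: p s {sV up} pth => [|x p ih] s /=.
    by rewrite /dist1 big1// => i _; rewrite subrr.
  move=> /andP[sx xp]; apply: leq_trans (dist1_triangle s x _) _.
  by rewrite (dE _ _ sx) add1n ltnS; exact: ih.
have /(uniq_leq_size up) : {subset s :: p <= enum_fset V}.
  move=> x; rewrite in_cons => /predU1P[->//|].
  elim: p s {sV up} pth => [//|y p ih] s /= /andP[sy yp].
  rewrite in_cons => /predU1P[->|]; last exact: ih yp.
  have [a [b [aV bV ab /fsetP/(_ y)]]] := gE _ sy.
  by rewrite !inE eqxx orbT => /esym/orP[] /eqP ->.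
by apply: leq_trans; rewrite /= leqnSn.
Qed.

Variables (R : realType) (r : R).

Lemma frakB_diameter B : frakB r B -> exists n : nat,
  [/\ n%:R <= r, (#|` B| <= 2 * n)%N &
      forall s t, s \in B -> t \in B -> (dist1 s t <= 2 * n)%N].
Proof.
move=> [B2 S1 Sr]; exists (lattice_size B).
move: S1 {Sr}(Sr); rewrite /lattice_size /nat_min.
(* The default value 0 contradicts [1 <= lattice_size B], so the minimum is attained by some
   graph. *)
case: xgetP => [n -> [[V [E [ocE BV ->]]] _] E1 Er|//].
have BV' : (B `<=` V)%fset by apply/fsubsetP.
have V2 := leq_trans B2 (fsubset_leq_card BV').
split=> //.
  exact: leq_trans (fsubset_leq_card BV') (one_connected_card ocE V2).
by move=> s t /BV sV /BV tV; exact: one_connected_dist1 ocE V2 sV tV.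
Qed.

Definition incident t : {fset {fset L}} :=
  fset_set [set B | frakB r B /\ t \in B].

Lemma finite_incident t : finite_set [set B | frakB r B /\ t \in B].
Proof.
pose M := (Num.truncn r).+1.
have rM : r <= M%:R by rewrite ltW// truncnS_gt.
pose ball := fset_set [set s : L | forall i, (`|s i - t i| <= 2 * M)%N].
apply: (@sub_finite_set _ _ [set` fpowerset ball]); last exact: finite_fset.
move=> B [/frakB_diameter[n [nr _ diamB]] tB] /=.
rewrite fpowersetE; apply/fsubsetP => s sB.
rewrite in_fset_set; last exact: finite_ball.
rewrite inE /= => i; apply: leq_trans (coordinate_le_dist1 s t i) _.
apply: leq_trans (diamB s t sB tB) _.
by rewrite leq_mul2l/= -(ler_nat R) (le_trans nr).
Qed.

Lemma incidentP t B : B \in incident t <-> frakB r B /\ t \in B.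
Proof.
rewrite in_fset_set; last exact: finite_incident.
by rewrite inE.
Qed.

(** Once [t] lies in some [B], every interaction set through [t] meets [B] and is counted by
    [degree B]. Positivity of [max_degree] excludes the default value of [nat_max]. *)
Lemma card_incident t : (0 < max_degree nu r)%N ->
  (#|` incident t| <= max_degree nu r)%N.
Proof.
have [->|/fset0Pn[B /incidentP[rB tB]]] := eqVneq (incident t) fset0.
  by rewrite cardfs0.
rewrite /max_degree /nat_max; case: xgetP => [_ -> [_ max] _|//].
apply: leq_trans (max (degree r B) _); last by exists B.
have fin : finite_set [set C | frakB r C /\ (C `&` B)%fset != fset0].
  apply: (@sub_finite_set _ _
    (\bigcup_(s in [set` B]) [set C | frakB r C /\ s \in C])).
    move=> C [rC /fset0Pn[s]]; rewrite inE => /andP[sC sB].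
    by exists s.
  by apply: bigcup_finite => // s _; exact: finite_incident.
apply: fsubset_leq_card; apply/fsubsetP => C /incidentP[rC tC].
rewrite in_fset_set// inE /=; split=> //.
by apply/fset0Pn; exists t; rewrite inE tC.
Qed.

(** Measures how strongly the conditional law at [t] can feel the spin at [s]: only interaction sets
    through both sites couple them. *)
Definition coincidence (s t : L) : nat := (\sum_(B <- incident t) (s \in B))%N.

Lemma coincidence_le s t : (coincidence s t <= #|` incident t|)%N.
Proof. by rewrite -sum1_size; apply: leq_sum => B _; case: (s \in B). Qed.

(** Double counting: after exchanging the sums, each set through [t] contributes its number of
    points in [W], at most [2 * r]. *)
Lemma sum_coincidence (W : {fset L}) t : (1 <= r) ->
  (\sum_(s <- W) coincidence s t)%:R <= #|` incident t|%:R * (2 * r) :> R.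
Proof.
move=> r1; rewrite exchange_big/= -sum1_size !natr_sum mulr_suml.
rewrite big_seq [leRHS]big_seq; apply: ler_sum => B /incidentP[rB _].
rewrite mul1r; have [n [nr Bn _]] := frakB_diameter rB.
apply: (@le_trans _ _ (2 * n%:R)); last by rewrite ler_pM2l.
rewrite -natrM ler_nat; apply: leq_trans Bn.
have -> : (\sum_(s <- W) (s \in B) = size [seq s <- W | s \in B])%N.
  rewrite size_filter -sum1_count [RHS]big_mkcond/=.
  by apply: eq_bigr => s _; case: (s \in B).
apply: uniq_leq_size; first exact/filter_uniq/fset_uniq.
by move=> s; rewrite mem_filter => /andP[].
Qed.

End Combinatorics.

(** * Smallness of the total influence of a site *)

Section Influence.
Variables (R : realType) (nu : nat) (r lambda : R).
Hypotheses (nu1 : (1 <= nu)%N) (r1 : 1 <= r).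
Hypotheses (lambda_ge0 : 0 <= lambda) (lambda_le : lambda <= lambda0 nu r).

(** From [expR (- x) >= 1 - x] one gets [expR x - 1 <= x / (1 - x)], and [1 - x >= 2^-1]. *)
Lemma expRB1_le (x : R) : 0 <= x <= 2^-1 -> expR x - 1 <= 2 * x.
Proof.
move=> /andP[x0 x1]; have := expR_ge1Dx (- x); have := expR_gt0 x.
by have := expRxMexpNx_1 x; nra.
Qed.

(* The factor [(8 * nu) `^ (2 * r)] of [lambda0] is only used through its lower
   bound [r]. *)
Lemma lambda_max_degree : lambda * (max_degree nu r)%:R * r <= 50^-1.
Proof.
have rX : r <= (8 * nu%:R) `^ (2 * r).
  have nuR : (1 <= nu%:R :> R) by rewrite ler1n.
  have x0 : (0 < 8 * nu%:R :> R) by lra.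
  (* With [y = 8 * nu], the inequality [expR (- ln y) >= 1 - ln y] gives the bound; the power is
     then [expR (2 * r * ln y) >= 1 + r]. *)
  have ln1 : 2^-1 <= ln (8 * nu%:R : R).
    have := expR_ge1Dx (- ln (8 * nu%:R : R)).
    rewrite expRN lnK ?posrE//.
    have : (8 * nu%:R)^-1 <= 2^-1 :> R by rewrite lef_pV2 ?posrE//; lra.
    by lra.
  rewrite /powR gt_eqF//; have := expR_ge1Dx (2 * r * ln (8 * nu%:R)).
  have r0 : 0 <= r by apply: le_trans r1.
  have := ler_wpM2l r0 ln1; set l := ln _; set E := expR _.
  by lra.
have D0 : 0 <= (max_degree nu r)%:R :> R by [].
have [D_eq0|D_neq0] := eqVneq ((max_degree nu r)%:R : R) 0.
  by rewrite D_eq0 mulr0 mul0r invr_ge0.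
have D_gt0 : 0 < (max_degree nu r)%:R :> R by rewrite lt_neqAle eq_sym D_neq0.
move: lambda_le; rewrite /lambda0; set X := _ `^ _ in rX *; set D := _%:R in D_gt0 *.
have DX : 0 < 50 * D * X.
  by rewrite !mulr_gt0//; apply: lt_le_trans rX; apply: lt_le_trans r1.
move=> lX.
have : lambda * (50 * D * X) <= 1.
  by apply: le_trans (ler_wpM2r (ltW DX) lX) _; rewrite mulVf// gt_eqF.
have : lambda * D * r <= lambda * D * X by rewrite ler_wpM2l// mulr_ge0// ltW.
by lra.
Qed.

(** Dobrushin's condition. Linearising the exponential and double counting bound the sum by
    [8 * lambda * n * (2 * r)], where [n] counts the interaction sets through [t]; this is at most
    [16 / 50]. *)
Lemma influence_le t (W : {fset lattice nu}) :
  \sum_(s <- W) (expR (4 * lambda * (coincidence r s t)%:R) - 1) <= 2^-1.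
Proof.
have [l0|lpos] := eqVneq lambda 0.
  by rewrite big1 ?invr_ge0// => s _; rewrite l0 mulr0 mul0r expR0 subrr.
have l_gt0 : 0 < lambda by rewrite lt_neqAle eq_sym lpos.
(* If [max_degree] were 0, the convention [0^-1 = 0] would give [lambda0 = 0], against
   [0 < lambda]. *)
have D_gt0 : (0 < max_degree nu r)%N.
  rewrite lt0n; apply: contraL (l_gt0) => /eqP D0.
  by rewrite -leNgt (le_trans lambda_le)// /lambda0 D0 mulr0 mul0r invr0.
have := lambda_max_degree; have := card_incident t D_gt0.
rewrite -(ler_nat R); set D := (max_degree nu r)%:R; set n := #|` _|%:R => nD lD.
have n0 : 0 <= n by [].
have r1' := r1; have lnr : lambda * n * r <= 50^-1.
  by apply: le_trans lD; rewrite ler_wpM2r ?ler_wpM2l//; lra.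
have ln0 : 0 <= lambda * n by rewrite mulr_ge0.
have ln : lambda * n <= 50^-1 by apply: le_trans lnr; rewrite ler_peMr.
apply: (@le_trans _ _ (\sum_(s <- W) (8 * lambda * (coincidence r s t)%:R))).
  apply: ler_sum => s _; apply: le_trans (expRB1_le _) _; last by lra.
  have : (coincidence r s t)%:R <= n by rewrite ler_nat coincidence_le.
  have : 0 <= (coincidence r s t)%:R :> R by [].
  by move=> c0 cn; apply/andP; split; nra.
rewrite -mulr_sumr -natr_sum.
by have := sum_coincidence W t r1; rewrite -/n; nra.
Qed.

End Influence.

(** * The algebra of local events and extension of premeasures *)

Section LocalEvents.
Variables (R : realType) (nu : nat).
Local Notation L := (lattice nu).
Local Notation Om := (Omega R nu).

Definition local_event (A : set Om) : Prop :=
  measurable A /\ exists Q : {fset L}, depends_on (mem Q) A.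

Lemma local_event0 : local_event set0.
Proof. by split=> //; exists fset0. Qed.

Lemma local_eventC A : local_event A -> local_event (~` A).
Proof.
move=> [mA [Q dA]]; split; first exact: measurableC.
by exists Q => w w' ww'; rewrite /setC/= (dA w w' ww').
Qed.

Lemma local_eventU A B : local_event A -> local_event B -> local_event (A `|` B).
Proof.
move=> [mA [Q dA]] [mB [Q' dB]]; split; first exact: measurableU.
exists (Q `|` Q')%fset => w w' ww'; rewrite /setU/=.
rewrite (dA w w') => [|s sQ]; last by apply: ww'; rewrite /= inE; apply/orP; left.
by rewrite (dB w w') => [|s sQ] //; apply: ww'; rewrite /= inE; apply/orP; right.
Qed.

Lemma Sigma_local_event (Q : {fset L}) A : Sigma_ Q A -> local_event A.
Proof.
move=> QA; split; first exact: Sigma_measurable_set QA.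
by exists Q; exact: Sigma_depends_on QA.
Qed.

(** A copy of the configuration space whose measurable sets are the local events, kept apart from
    the sigma-algebra carried by [Omega]. *)
Definition local_algebra : Type := Om.
HB.instance Definition _ := Pointed.on local_algebra.
Fact local_display : measure_display. Proof. exact: default_measure_display. Qed.
HB.instance Definition _ := isAlgebraOfSets.Build local_display local_algebra
  local_event0 local_eventU local_eventC.

(** Caratheodory's extension lives on the sigma-algebra generated by local events. Coordinate sets
    are local, so the identity map to [Omega] is measurable and the extension is pushed forward
    along it. *)
Lemma premeasure_extension (mu : set local_algebra -> \bar R) :
  mu set0 = 0%E -> (forall A, 0 <= mu A)%E -> semi_sigma_additive mu ->
  mu setT = 1%E ->
  exists P : probability Om R, forall A, local_event A -> P A = mu A.
Proof.
move=> mu0 mu_ge0 mu_sigma muT.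
pose m : {measure set local_algebra -> \bar R} :=
  HB.pack_for (measure local_algebra R) mu
    (isMeasure.Build _ _ _ mu mu0 mu_ge0 mu_sigma).
pose I := g_sigma_algebraType (@measurable _ local_algebra).
pose id' (w : I) : Om := w.
have mid : measurable_fun setT id'.
  apply: measurable_configuration => t _ F mF; rewrite setTI.
  apply: sub_sigma_algebra; apply: (@Sigma_local_event [fset t]%fset).
  by apply: sub_sigma_algebra; exists t; [rewrite /= inE|exists F].
pose p0 : {measure set Om -> \bar R} := pushforward (measure_extension m) id'.
pose p := p0 mid.
have pE A : local_event A -> p A = mu A.
  move=> lA; rewrite /p /= /pushforward /=.
  exact: (@measurable_mu_extE _ R local_algebra m A lA).
have pT : p setT = 1%E.
  by rewrite pE// -setC0; apply: local_eventC; exact: local_event0.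
pose q : probability Om R := HB.pack_for (probability Om R) (Measure.sort p)
  (Measure.class p) (Measure_isProbability.Build _ _ _ p pT).
by exists q => A lA; exact: pE.
Qed.

End LocalEvents.

Lemma big_fset_subset (R : nmodType) (K : choiceType) (A B : {fset K})
  (F : K -> R) : (A `<=` B)%fset ->
  \sum_(x <- B | x \in A) F x = \sum_(x <- A) F x.
Proof.
move=> AB; rewrite -big_filter; apply: perm_big; apply: uniq_perm.
- exact/filter_uniq/fset_uniq.
- exact: fset_uniq.
- move=> x; rewrite mem_filter; apply: andb_idr => xA.
  exact: (fsubsetP AB).
Qed.

(** * Interactions and finite-volume energies *)

Section Gibbs.
Variables (R : realType) (nu : nat).
Local Notation L := (lattice nu).
Local Notation Om := (Omega R nu).
Variables (P : L -> probability (measurableTypeR R) R) (P0 : probability Om R).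
Hypothesis P0_prod : is_product_probability P P0.
Variables (r lambda : R) (Phi : {fset L} -> Om -> R).
Hypothesis Phi_meas : forall B, frakB r B -> Sigma_measurable B (Phi B).
Hypothesis Phi_bound : forall B, frakB r B -> forall w, `|Phi B w| <= lambda.
Local Notation U_ := (U_ r Phi).
Local Notation incident := (incident r).
Implicit Types (f g : Om -> R) (W Q : {fset L}) (w : Om).

(** The level set of [Phi B] through [w] is an event of [Sigma_ B], so it contains every
    configuration agreeing with [w] on [B]. *)
Lemma depends_on_Phi B : frakB r B -> depends_on (mem B) (Phi B).
Proof.
move=> rB w w' ww'.
have mA : Sigma_ B (Phi B @^-1` [set Phi B w]).
  by rewrite -[X in Sigma_ B X]setTI; apply: (Phi_meas rB).
have := Sigma_depends_on mA ww'.
by rewrite /preimage/= => /esym; rewrite propeqE => -[_ /(_ erefl)] ->.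
Qed.

Lemma bounded_measurable_Phi B : frakB r B -> bounded_measurable (Phi B).
Proof.
move=> rB; split; last by exists lambda; exact: Phi_bound.
move=> _ F mF; apply: Sigma_measurable_set.
exact: (Phi_meas rB measurableT mF).
Qed.

Definition incidents Q : {fset {fset L}} := (\bigcup_(t <- Q) incident t)%fset.

Lemma incidentsP Q B :
  B \in incidents Q <-> frakB r B /\ exists2 t, t \in Q & t \in B.
Proof.
split=> [/bigfcupP[t]|[rB [t tQ tB]]].
  by rewrite andbT => tQ /incidentP[rB tB]; split=> //; exists t.
by apply/bigfcupP; exists t; rewrite ?tQ//; apply/incidentP.
Qed.

Lemma incidents1 t : incidents [fset t]%fset = incident t.
Proof. by rewrite /incidents big_seq_fset1. Qed.

(** In a large box this is the whole part of [U_ N] that can depend on the sites of [Q]. *)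
Definition energy Q w : R := \sum_(B <- incidents Q) Phi B w.

Lemma bounded_measurable_energy Q : bounded_measurable (energy Q).
Proof.
by apply: bounded_measurable_sum => B /incidentsP[rB _]; exact: bounded_measurable_Phi.
Qed.

Definition hull Q : {fset L} := (\bigcup_(B <- incidents Q) B)%fset.

Lemma depends_on_energy Q : depends_on (mem (hull Q)) (energy Q).
Proof.
move=> w w' ww'; rewrite /energy big_seq [RHS]big_seq; apply: eq_bigr => B BQ.
have [rB _] := (incidentsP Q B).1 BQ.
apply: (depends_on_Phi rB) => t tB; apply: ww'.
by apply/bigfcupP; exists B; rewrite ?BQ.
Qed.

Definition inside N : {fset {fset L}} :=
  fset_set [set B | frakB r B /\ [set` B] `<=` box N].

Lemma finite_inside N : finite_set [set B | frakB r B /\ [set` B] `<=` @box nu N].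
Proof.
apply: (@sub_finite_set _ _ [set` fpowerset (fset_set (@box nu N))]);
  last exact: finite_fset.
move=> B [_ BN] /=; rewrite fpowersetE; apply/fsubsetP => s sB.
by rewrite in_fset_set; [rewrite inE; exact: BN|exact: finite_box].
Qed.

Lemma insideP N B : B \in inside N <-> frakB r B /\ [set` B] `<=` box N.
Proof. by rewrite in_fset_set; [rewrite inE|exact: finite_inside]. Qed.

Lemma U_inside N w : U_ N w = \sum_(B <- inside N) Phi B w.
Proof. by rewrite /Defs.U_ fsbig_finite//; exact: finite_inside. Qed.

Lemma bounded_measurable_U N : bounded_measurable (U_ N).
Proof.
have -> : U_ N = fun w => \sum_(B <- inside N) Phi B w.
  by apply/funext => w; exact: U_inside.
by apply: bounded_measurable_sum => B /insideP[rB _]; exact: bounded_measurable_Phi.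
Qed.

Lemma incidents_inside Q : \forall N \near \oo, (incidents Q `<=` inside N)%fset.
Proof.
pose M := (\max_(B <- incidents Q) \max_(s <- B) \max_(i < nu) `|s i|)%N.
exists M => // N /= MN; apply/fsubsetP => B BQ; apply/insideP.
have [rB _] := (incidentsP Q B).1 BQ.
split=> // s sB i; apply: leq_trans MN.
apply: leq_trans (leq_bigmax_seq _ BQ isT).
apply: leq_trans (leq_bigmax_seq _ sB isT).
exact: (leq_bigmax i).
Qed.

Definition split_energy Q N := exists rest : Om -> R,
  [/\ bounded_measurable rest, depends_on (predC (mem Q)) rest &
      forall w, U_ N w = energy Q w + rest w].

Lemma split_energy_near Q : \forall N \near \oo, split_energy Q N.
Proof.
apply: filterS (incidents_inside Q) => N QN.
exists (fun w => \sum_(B <- inside N | B \notin incidents Q) Phi B w); split.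
- rewrite (_ : (fun _ => _) = fun w =>
      \sum_(B <- [seq B <- inside N | B \notin incidents Q]) Phi B w).
    apply: bounded_measurable_sum => B.
    rewrite mem_filter => /andP[_ /insideP[rB _]].
    exact: bounded_measurable_Phi.
  by apply/funext => w; rewrite big_filter.
- move=> w w' ww'; rewrite big_seq_cond [RHS]big_seq_cond; apply: eq_bigr => B.
  move=> /andP[/insideP[rB _] BQ]; apply: (depends_on_Phi rB) => t tB.
  apply: ww'; rewrite !inE; apply: contra BQ => tQ.
  by apply/incidentsP; split=> //; exists t.
- move=> w; rewrite U_inside (bigID [in incidents Q])/=; congr (_ + _).
  by rewrite big_fset_subset.
Qed.

(** * Gibbs means and the single-site heat bath *)

Definition gibbs N f : R :=
  (\int[P0]_w (f w * expR (U_ N w))) / \int[P0]_w expR (U_ N w).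

Lemma gibbs_bounds N f (a b : R) : bounded_measurable f ->
  (forall w, a <= f w <= b) -> a <= gibbs N f <= b.
Proof.
move=> bf fab; have bU := bounded_measurable_U N.
have bc c : bounded_measurable (fun w => c * expR (U_ N w)).
  exact/bounded_measurableM/bounded_measurable_expR/bU/bounded_measurable_cst.
have bfU := bounded_measurableM bf (bounded_measurable_expR bU).
rewrite /gibbs ler_pdivlMr ?ler_pdivrMr ?mean_expR_gt0//.
rewrite -!meanZ; try exact: bounded_measurable_expR.
by apply/andP; split; apply: le_mean => // w; rewrite ler_wpM2r ?expR_ge0//;
  case/andP: (fab w).
Qed.

(** The Gibbs conditional expectation of [f] given all sites but [t]: terms of [U_ N] away from [t]
    cancel in the quotient, so one operator serves all large boxes. *)
Definition heat_bath t f w : R :=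
  resample P0 (pred1 t) (fun w' => f w' * expR (energy [fset t]%fset w')) w /
  resample P0 (pred1 t) (fun w' => expR (energy [fset t]%fset w')) w.

Lemma resample_expR_gt0 D g w : bounded_measurable g ->
  0 < resample P0 D (fun w' => expR (g w')) w.
Proof. by move=> bg; apply: mean_expR_gt0; exact: bounded_measurable_splice. Qed.

Lemma bounded_measurable_heat_bath t f : bounded_measurable f ->
  bounded_measurable (heat_bath t f).
Proof.
move=> bf; have bE := bounded_measurable_energy [fset t]%fset.
have beE := bounded_measurable_expR bE.
have [mn _] := (mean_resample P0_prod (pred1 t) (bounded_measurableM bf beE)).1.
have [md _] := (mean_resample P0_prod (pred1 t) beE).1.
have [_ [M fM]] := bf.
split.
  (* Writing the inverse as [expR (- ln _)] reduces measurability of the quotient to that of [expR]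
     and [ln]. *)
  have -> : heat_bath t f = fun w =>
      resample P0 (pred1 t) (fun w' => f w' * expR (energy [fset t]%fset w')) w *
      expR (- ln (resample P0 (pred1 t)
        (fun w' => expR (energy [fset t]%fset w')) w)).
    apply/funext => w; rewrite expRN lnK//.
    by rewrite posrE resample_expR_gt0.
  apply: measurable_funM => //; apply: measurableT_comp => //.
  by apply: measurable_funN; exact: measurableT_comp (@measurable_ln R) md.
exists M => w; have Z0 := resample_expR_gt0 (pred1 t) w bE.
rewrite normrM normfV (gtr0_norm Z0) ler_pdivrMr//.
have bgE := bounded_measurable_splice (pred1 t) w bE.
have bgf := bounded_measurable_splice (pred1 t) w bf.
have begE := bounded_measurable_expR bgE.
apply: le_trans (mean_norm _ (bounded_measurableM bgf begE)) _.
rewrite -meanZ; last exact: begE.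
apply: le_mean => [||w'].
- exact/bounded_measurable_norm/(bounded_measurableM bgf begE).
- by apply: bounded_measurableM;
    [exact: bounded_measurable_cst|exact: bounded_measurable_expR].
- by rewrite normrM (ger0_norm (expR_ge0 _)) ler_wpM2r ?expR_ge0.
Qed.

Lemma depends_on_heat_bath t f (C : {pred L}) : depends_on C f ->
  depends_on [predD [predU C & mem (hull [fset t]%fset)] & pred1 t] (heat_bath t f).
Proof.
move=> df; set D := [predU C & mem (hull [fset t]%fset)].
have dE : depends_on D (fun w => expR (energy [fset t]%fset w)).
  move=> w w' ww'; congr expR; apply: depends_on_energy => s st.
  by apply: ww'; rewrite !inE/= st orbT.
have dfE : depends_on D (fun w => f w * expR (energy [fset t]%fset w)).
  move=> w w' ww'; congr (_ * _); last exact: dE.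
  by apply: df => s sC; apply: ww'; rewrite !inE/= sC.
move=> w w' ww'; rewrite /heat_bath.
by rewrite (depends_on_resample P0 dfE ww') (depends_on_resample P0 dE ww').
Qed.

(** Averaging first over the spin at [t], the factor [expR (rest w)] and the heat bath itself come
    out of the average; what remains is the denominator of [heat_bath], which cancels. *)
Lemma gibbs_heat_bath t f : bounded_measurable f ->
  \forall N \near \oo, gibbs N (heat_bath t f) = gibbs N f.
Proof.
move=> bf; apply: filterS (split_energy_near [fset t]%fset).
move=> N [rest [brest drest UE]].
rewrite /gibbs; congr (_ * _).
have bU := bounded_measurable_U N.
have bh := bounded_measurable_heat_bath t bf.
have bE := bounded_measurable_energy [fset t]%fset.
have dr : depends_on [predC pred1 t] (fun w => expR (rest w)).
  by move=> w w' ww'; congr expR; apply: drest => s; rewrite !inE => st; exact: ww'.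
have beU := bounded_measurable_expR bU.
rewrite -(mean_resample P0_prod (pred1 t) (bounded_measurableM bh beU)).2.
rewrite -(mean_resample P0_prod (pred1 t) (bounded_measurableM bf beU)).2.
apply: eq_mean => w.
have -> : (fun w => heat_bath t f w * expR (U_ N w)) = fun w =>
    (heat_bath t f w * expR (rest w)) * expR (energy [fset t]%fset w).
  by apply/funext => w'; rewrite UE expRD mulrCA mulrC.
have -> : (fun w => f w * expR (U_ N w)) = fun w =>
    expR (rest w) * (f w * expR (energy [fset t]%fset w)).
  by apply/funext => w'; rewrite UE expRD mulrA mulrC.
have dh : depends_on [predC pred1 t] (heat_bath t f).
  have dT : depends_on predT f.
    by move=> v v' vv'; congr (f _); apply/funext => s; exact: (vv' s isT).
  move=> v v' vv'; apply: (depends_on_heat_bath dT) => s.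
  by rewrite !inE andbT => st; apply: vv'; rewrite !inE.
have dhr : depends_on [predC pred1 t]
    (fun w => heat_bath t f w * expR (rest w)).
  by move=> v v' vv'; rewrite (dh v v' vv') (dr v v' vv').
rewrite (resampleM P0 w dhr (bounded_measurable_expR bE)).
rewrite (resampleM P0 w dr (bounded_measurableM bf (bounded_measurable_expR bE))).
rewrite mulrAC mulrC; congr (_ * _); rewrite /heat_bath mulfVK//.
by rewrite gt_eqF// resample_expR_gt0.
Qed.


(** * Oscillations, their contraction under sweeps, and convergence *)

Definition oscillation f (d : L -> R) :=
  forall t w w', {in predC1 t, forall s, w s = w' s} -> `|f w - f w'| <= d t.

Lemma oscillation_ge0 f d t : oscillation f d -> 0 <= d t.
Proof. by move=> fd; apply: le_trans (fd t point point _). Qed.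

Lemma oscillation_bounded f : bounded_measurable f -> exists d, oscillation f d.
Proof.
move=> [_ [M fM]]; exists (fun=> M + M) => t w w' _.
by rewrite (le_trans (ler_normB _ _))// lerD.
Qed.

Lemma oscillation_restrict W f d : depends_on (mem W) f -> oscillation f d ->
  oscillation f (fun s => if s \in W then d s else 0).
Proof.
move=> df fd t w w' ww'; case: ifPn => tW; first exact: fd.
rewrite (df w w') ?subrr ?normr0// => s sW; apply: ww'.
by rewrite !inE; apply: contraNneq tW => <-.
Qed.

(** Telescoping: the sites of [W] are switched from [w] to [w'] one at a time. *)
Lemma le_sum_oscillation W f d : depends_on (mem W) f -> oscillation f d ->
  forall w w', `|f w - f w'| <= \sum_(s <- W) d s.
Proof.
move=> df fd w w'.
have step (l : seq L) : forall v v', {in predC (mem l), forall s, v s = v' s} ->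
    `|f v - f v'| <= \sum_(s <- l) d s.
  elim: l => [|t l ih] v v' vv'.
    rewrite big_nil (_ : v = v') ?subrr ?normr0//.
    by apply/funext => s; apply: vv'; rewrite !inE.
  rewrite big_cons; pose u := splice (pred1 t) v v'.
  rewrite (_ : f v - f v' = (f v - f u) + (f u - f v')); last by rewrite addrA subrK.
  apply: le_trans (ler_normD _ _) (lerD _ _).
    by apply: fd => s; rewrite /u /splice !inE => /negbTE ->.
  apply: ih => s; rewrite /u /splice !inE => sl; case: eqP => [//|/eqP st].
  by apply: vv'; rewrite !inE negb_or st.
rewrite -(df (splice (mem W) w w') w'); last by move=> s sW; rewrite /splice sW.
by apply: step => s; rewrite !inE /splice => /negbTE ->.
Qed.

Lemma energy1_diff t s w w' : {in predC1 s, forall x, w x = w' x} ->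
  `|energy [fset t]%fset w - energy [fset t]%fset w'| <=
  2 * lambda * (coincidence r s t)%:R.
Proof.
move=> ww'; rewrite /energy incidents1 -sumrB.
apply: le_trans (ler_norm_sum _ _ _) _.
rewrite /coincidence natr_sum mulr_sumr big_seq [leRHS]big_seq.
apply: ler_sum => B /incidentP[rB _].
case: (boolP (s \in B)) => sB; rewrite ?mulr1 ?mulr0.
  rewrite mulr_natl mulr2n (le_trans (ler_normB _ _))// lerD//; exact: Phi_bound.
rewrite (depends_on_Phi rB (w' := w')) ?subrr ?normr0// => x xB.
by apply: ww'; rewrite !inE; apply: contraNneq sB => <-.
Qed.

Local Notation influence s t := (expR (4 * lambda * (coincidence r s t)%:R) - 1).

(** The spin at [t] has been averaged out. A change at another site [s] acts on [f], at cost [d s],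
    and on the conditional law at [t]. The energy at [t] moves by at most
    [k = 2 * lambda * coincidence r s t], so [tilted_mean_diff] charges [expR (2 * k) - 1] times the
    variation [d t] of [f] around its value [m] at [w']. *)
Lemma oscillation_heat_bath t f d : bounded_measurable f -> oscillation f d ->
  oscillation (heat_bath t f)
    (fun s => if s == t then 0 else d s + influence s t * d t).
Proof.
move=> bf fd s w w' ww'; case: eqP => [st|/eqP st].
  suff E : heat_bath t f w = heat_bath t f w' by rewrite E subrr normr0.
  have dT : depends_on predT f.
    by move=> v v' vv'; congr (f _); apply/funext => x; exact: (vv' x isT).
  apply: (depends_on_heat_bath dT) => x.
  by rewrite !inE andbT => xt; apply: ww'; rewrite !inE st.
have bE := bounded_measurable_energy [fset t]%fset.
have gg x : {in predC1 s, forall y, splice (pred1 t) w x y = splice (pred1 t) w' x y}.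
  by move=> y ys; rewrite /splice; case: ifP => // _; exact: ww'.
have -> : 4 * lambda * (coincidence r s t)%:R =
    2 * (2 * lambda * (coincidence r s t)%:R) by lra.
apply: (tilted_mean_diff P0 (m := f (splice (pred1 t) w' w'))
  (bounded_measurable_splice _ _ bE) (bounded_measurable_splice _ _ bE)
  (bounded_measurable_splice _ _ bf) (bounded_measurable_splice _ _ bf)) => x.
- exact: energy1_diff (gg x).
- exact: fd (gg x).
- by apply: fd => y; rewrite /splice !inE => /negbTE ->.
Qed.

Hypothesis influence_half : forall t W, \sum_(s <- W) influence s t <= 2^-1.
Hypothesis lambda_ge0 : 0 <= lambda.

(** Resampling [t] trades [d t] for at most half of it, spread over other sites. The rest of the
    sweep counts every site with weight at most 1, so this half does not grow, whether or not its
    new sites are still to be visited. *)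
Lemma sweep (l : seq L) W f d : uniq l -> {subset l <= W} ->
  bounded_measurable f -> depends_on (mem W) f -> oscillation f d ->
  exists g W' d', [/\ bounded_measurable g, depends_on (mem W') g,
    oscillation g d', \forall N \near \oo, gibbs N g = gibbs N f &
    \sum_(s <- W') d' s <= \sum_(s <- W) (if s \in l then 2^-1 else 1) * d s].
Proof.
elim: l W f d => [|t l ih] W f d /= => [_ _|/andP[tl ul] lW] bf df fd.
  exists f, W, d; split=> //; first exact: nearW.
  by under [leRHS]eq_bigr do rewrite mul1r.
pose f1 := heat_bath t f.
pose W1 := (W `|` hull [fset t])%fset.
pose d1 s := if s == t then 0 else
  (if s \in W then d s else 0) + influence s t * d t.
have tW : t \in W by apply: lW; rewrite mem_head.
have bf1 : bounded_measurable f1 by exact: bounded_measurable_heat_bath.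
have df1 : depends_on (mem W1) f1.
  move=> w w' ww'; apply: (depends_on_heat_bath df) => s.
  by rewrite !inE => /andP[_ sW]; apply: ww'; rewrite !inE.
have fd1 : oscillation f1 d1.
  by have := oscillation_heat_bath t bf (oscillation_restrict df fd); rewrite tW.
have lW1 : {subset l <= W1}.
  by move=> s sl; rewrite inE lW// in_cons sl orbT.
have [g [W' [d' [bg dg gd' Ng sd']]]] := ih W1 f1 d1 ul lW1 bf1 df1 fd1.
exists g, W', d'; split=> //.
  by apply: filterS2 Ng (gibbs_heat_bath t bf) => N -> ->.
apply: le_trans sd' _.
have dt0 := oscillation_ge0 t fd.
have infl0 s : 0 <= influence s t.
  by rewrite subr_ge0 -expR0 ler_expR !mulr_ge0.
(* The original oscillations keep the weights of the remaining list [l]; those handed over by [t]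
   get weight 1. *)
apply: (@le_trans _ _ (\sum_(s <- W1) ((if s \in W then
    (if s == t then 0 else (if s \in l then 2^-1 else 1) * d s) else 0) +
    influence s t * d t))).
  apply: ler_sum => s _; rewrite /d1; case: (eqVneq s t) => [->|st].
    by rewrite mulr0 tW add0r mulr_ge0.
  rewrite mulrDr lerD//; first by case: (s \in W); rewrite ?mulr0.
  rewrite ler_piMl//; first by rewrite mulr_ge0.
  by case: ifP => // _; rewrite invf_le1// ler1n.
rewrite big_split/= -mulr_suml -big_mkcond/=.
rewrite big_fset_subset; last exact: fsubsetUl.
rewrite (bigD1_seq t tW (fset_uniq W))/= eqxx add0r.
rewrite [leRHS](bigD1_seq t tW (fset_uniq W))/= mem_head addrC lerD//.
  by rewrite ler_wpM2r.
rewrite big_seq_cond [leRHS]big_seq_cond.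
by apply: ler_sum => s /andP[_ /negbTE st]; rewrite in_cons st.
Qed.

Lemma iterated_sweep (k : nat) W f d :
  bounded_measurable f -> depends_on (mem W) f -> oscillation f d ->
  exists g W' d', [/\ bounded_measurable g, depends_on (mem W') g,
    oscillation g d', \forall N \near \oo, gibbs N g = gibbs N f &
    \sum_(s <- W') d' s <= 2^-1 ^+ k * \sum_(s <- W) d s].
Proof.
elim: k W f d => [|k ih] W f d bf df fd.
  by exists f, W, d; split=> //; [exact: nearW|rewrite expr0 mul1r].
have [g [W1 [d1 [bg dg gd1 Ng sd1]]]] :=
  @sweep W W f d (fset_uniq W) (fun s sW => sW) bf df fd.
have [h [W2 [d2 [bh dh hd2 Nh sd2]]]] := ih W1 g d1 bg dg gd1.
exists h, W2, d2; split=> //.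
  by apply: filterS2 Nh Ng => N -> ->.
apply: le_trans sd2 _; rewrite exprSr -mulrA ler_wpM2l// ?exprn_ge0//.
apply: le_trans sd1 _; rewrite mulr_sumr big_seq [leRHS]big_seq.
by apply: ler_sum => s ->.
Qed.

(** After enough sweeps [f] is replaced by a function [g] within [e] of the constant [g point]. For
    large [N] the means of [f] and [g] agree, hence lie within [e] of a value independent of [N]. *)
Lemma gibbs_cvg W f : bounded_measurable f -> depends_on (mem W) f ->
  cvgn (gibbs ^~ f).
Proof.
move=> bf df; have [d fd] := oscillation_bounded bf.
apply/cauchy_cvgP/cauchy_exP => e e0.
set D := \sum_(s <- W) d s.
have D0 : 0 <= D by apply: sumr_ge0 => s _; exact: oscillation_ge0 fd.
have [k kD] : exists k, 2^-1 ^+ k * D < e.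
  (* This [k] exceeds [D / e], and [k < 2 ^ k]. *)
  pose k := (Num.truncn (D / e)).+1; exists k.
  have : D / e < (2 ^ k)%N%:R.
    by apply: lt_trans (truncnS_gt _) _; rewrite ltr_nat ltn_expl.
  rewrite natrX ltr_pdivrMr// mulrC => Dek.
  by rewrite exprVn ltr_pdivrMl ?exprn_gt0// mulrC.
have [g [W' [d' [bg dg gd' Ng sd']]]] := iterated_sweep k bf df fd.
exists (g point); rewrite /nbhs/=; near=> N.
rewrite /ball/=.
have <- : gibbs N g = gibbs N f by near: N.
have := @gibbs_bounds N g (g point - 2^-1 ^+ k * D) (g point + 2^-1 ^+ k * D) bg.
have gb w : `|g w - g point| <= 2^-1 ^+ k * D.
  exact: le_trans (le_sum_oscillation dg gd' _ _) _.
move=> H.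
have /H/andP[] : forall w, g point - 2^-1 ^+ k * D <= g w <= g point + 2^-1 ^+ k * D.
  by move=> w; have := gb w; rewrite ler_distl.
move=> h1 h2; rewrite ltr_distl; apply/andP; split; lra.
Unshelve. all: by end_near. Qed.

(** * Unnormalised conditional expectations and their limits *)

Definition conditional Q f w (N : nat) : R :=
  resample P0 (predC (mem Q)) (fun w' => f w' * expR (U_ N w')) w /
  \int[P0]_w' expR (U_ N w').

(** The spins of [w'] in [Q] are overwritten by those of [w]; the exponential is the resulting ratio
    of Boltzmann weights in a large box. *)
Definition conditional_weight Q f w : Om -> R := fun w' =>
  f (splice (predC (mem Q)) w w') *
  expR (energy Q (splice (predC (mem Q)) w w') - energy Q w').

Lemma bounded_measurable_conditional_weight Q f w : bounded_measurable f ->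
  bounded_measurable (conditional_weight Q f w).
Proof.
move=> bf; apply: bounded_measurableM; first exact: bounded_measurable_splice.
apply/bounded_measurable_expR/bounded_measurableB.
  exact/bounded_measurable_splice/bounded_measurable_energy.
exact: bounded_measurable_energy.
Qed.

Lemma depends_on_conditional_weight Q W f w : depends_on (mem W) f ->
  depends_on (mem (W `|` hull Q)%fset) (conditional_weight Q f w).
Proof.
move=> df w1 w2 w12; rewrite /conditional_weight.
have sE (D : {fset L}) : {subset D <= (W `|` hull Q)%fset} ->
    {in mem D, forall s, splice (predC (mem Q)) w w1 s =
                         splice (predC (mem Q)) w w2 s}.
  by move=> DW s sD; rewrite /splice; case: ifP => // _; apply: w12; exact: DW.
congr (_ * expR (_ - _)).
- by apply: df; apply: sE => s sW; rewrite inE sW.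
- by apply: depends_on_energy; apply: sE => s sQ; rewrite inE sQ orbT.
- by apply: depends_on_energy => s sQ; apply: w12; rewrite !inE/= sQ orbT.
Qed.

(* Freezing the configuration in [Q] changes [U_ N] only through the terms
   touching [Q], so it amounts to averaging a local function. *)
Lemma conditional_gibbs Q f : \forall N \near \oo, forall w,
  conditional Q f w N = gibbs N (conditional_weight Q f w).
Proof.
apply: filterS (split_energy_near Q) => N [rest [_ drest UE]] w.
rewrite /conditional /gibbs; apply: (congr1 (fun x => x / _)); apply: eq_mean => w'.
rewrite /conditional_weight -mulrA -expRD; congr (_ * expR _).
rewrite !UE (drest (splice (predC (mem Q)) w w') w'); first by rewrite addrA subrK.
by move=> s; rewrite /splice !inE => ->.
Qed.

Lemma conditional_cvg Q W f w : bounded_measurable f -> depends_on (mem W) f ->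
  cvgn (conditional Q f w).
Proof.
move=> bf df.
have /cvg_ex[l gl] := gibbs_cvg (bounded_measurable_conditional_weight Q w bf)
  (depends_on_conditional_weight w df).
apply/cvg_ex; exists l; apply: cvg_trans gl; apply: near_eq_cvg.
by apply: filterS (conditional_gibbs Q f) => N ->.
Qed.

(** The ratio of Boltzmann weights is at most [expR (K + K)] when [K] bounds the energy of [Q].
    Uniformity in [f] and [w] is what dominated convergence requires later. *)
Lemma conditional_bound Q (M : R) : exists C : R, forall f, bounded_measurable f ->
  (forall w, `|f w| <= M) ->
  \forall N \near \oo, forall w, `|conditional Q f w N| <= C.
Proof.
have [_ [K EK]] := bounded_measurable_energy Q.
exists (M * expR (K + K)) => f bf fM.
apply: filterS (conditional_gibbs Q f) => N cE w; rewrite cE ler_norml.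
apply: gibbs_bounds; first exact: bounded_measurable_conditional_weight.
move=> w'; rewrite -ler_norml normrM (ger0_norm (expR_ge0 _)).
apply: ler_pM => //.
rewrite ler_expR; apply: le_trans (ler_norm _) _.
by apply: le_trans (ler_normB _ _) _; rewrite lerD.
Qed.

Definition conditional_limit Q f w : R := limn (conditional Q f w).

Lemma conditional_limit_bound Q (M : R) : exists C : R, forall f W,
  bounded_measurable f -> depends_on (mem W) f -> (forall w, `|f w| <= M) ->
  forall w, `|conditional_limit Q f w| <= C.
Proof.
have [C fC] := conditional_bound Q M; exists C => f W bf df fM w.
have cf : cvgn (conditional Q f w) by exact: conditional_cvg df.
have cnf : `|conditional Q f w N| @[N --> \oo] --> `|conditional_limit Q f w|.
  by apply: cvg_norm; exact: cf.
rewrite -(cvg_lim (@Rhausdorff R) cnf); apply: limr_le.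
  by apply/cvg_ex; eexists; exact: cnf.
by apply: filterS (fC f bf fM) => N fCN; exact: fCN.
Qed.

Lemma le_conditional_limit Q W W' f g w :
  bounded_measurable f -> depends_on (mem W) f ->
  bounded_measurable g -> depends_on (mem W') g ->
  (forall w, f w <= g w) -> conditional_limit Q f w <= conditional_limit Q g w.
Proof.
move=> bf df bg dg fg; apply: ler_lim.
- exact: conditional_cvg df.
- exact: conditional_cvg dg.
apply: nearW => N; have bU := bounded_measurable_U N.
have beU := bounded_measurable_expR bU.
rewrite ler_wpM2r ?invr_ge0 ?(ltW (mean_expR_gt0 _ bU))//.
apply: le_mean => [||w'].
- exact: (bounded_measurable_splice _ _ (bounded_measurableM bf beU)).
- exact: (bounded_measurable_splice _ _ (bounded_measurableM bg beU)).
- by rewrite ler_wpM2r ?expR_ge0.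
Qed.

Lemma conditional_limit_fset0 f w : conditional_limit fset0 f w = limn (gibbs ^~ f).
Proof.
by [].
Qed.

Lemma conditional_limit_eq0 Q f w : bounded_measurable f ->
  depends_on (mem Q) f -> f w = 0 -> conditional_limit Q f w = 0.
Proof.
move=> bf df fw0; apply/cvg_lim; first exact: Rhausdorff.
apply: cvg_near_cst; apply: nearW => N.
have dfC : depends_on [predC (predC (mem Q))] f.
  by move=> v v' vv'; apply: df => s sQ; apply: vv'; rewrite !inE negbK.
rewrite /conditional (resampleM P0 w dfC) ?fw0 ?mul0r//.
exact/bounded_measurable_expR/bounded_measurable_U.
Qed.

(** In finite volume this is the tower property of [resample]: all these quotients share the full
    partition function, so releasing frozen sites is plain integration against [P0]. The bound
    uniform in the configuration lets the identity pass to the limit. *)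
Lemma conditional_limit_tower Q Q' W f w : {subset Q <= Q'} ->
  bounded_measurable f -> depends_on (mem W) f ->
  bounded_measurable
    (fun w' => conditional_limit Q' f (splice (predC (mem Q)) w w')) /\
  \int[P0]_w' conditional_limit Q' f (splice (predC (mem Q)) w w') =
  conditional_limit Q f w.
Proof.
move=> QQ' bf df; have [_ [M fM]] := bf.
have [C fC] := conditional_bound Q' M.
pose D := predC (mem Q); pose D' := predC (mem Q').
pose F N w' := conditional Q' f (splice D w w') N.
have bfU N :=
  bounded_measurableM bf (bounded_measurable_expR (bounded_measurable_U N)).
have brU N := (mean_resample P0_prod D' (bfU N)).1.
have bF N : bounded_measurable (F N).
  apply: bounded_measurableM; last exact: bounded_measurable_cst.
  exact: (bounded_measurable_splice _ _ (brU N)).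
have FE N : \int[P0]_w' F N w' = conditional Q f w N.
  have D'D : {subset D' <= D}.
    by move=> s; rewrite !inE; apply: contra; exact: QQ'.
  rewrite /conditional -(resample_resample P0_prod w D'D (bfU N)) mulrC.
  rewrite -meanZ; last exact: (bounded_measurable_splice _ _ (brU N)).
  by apply: eq_mean => w'; rewrite mulrC.
have [|||bl] := @mean_dominated_cvg _ _ R P0 F
  (fun w' => conditional_limit Q' f (splice D w w')) C.
- by move=> N; have [] := bF N.
- by apply: filterS (fC f bf fM) => N fCN w'; exact: fCN.
- by move=> w'; exact: conditional_cvg df.
under eq_fun do rewrite FE; move=> cl; split=> //.
by apply/esym/cvg_lim => //; exact: Rhausdorff.
Qed.

(* The Ionescu-Tulcea argument: as long as the conditional expectation of
   [A n] given the sites seen so far does not tend to 0, the configuration can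
   be prolonged to the next sites with the same property. *)
Lemma gibbs_limit_continuous0 (A : nat -> set Om) (W : nat -> {fset L}) :
  (forall n, measurable (A n)) -> (forall n, depends_on (mem (W n)) (A n)) ->
  (forall n, A n.+1 `<=` A n) -> \bigcap_n A n = set0 ->
  limn (gibbs ^~ (\1_(A n) : Om -> R)) @[n --> \oo] --> 0.
Proof.
move=> mA dA Asub A0; apply/not_notP => A_not0.
(* [V k] gathers the supports of the events before [A k], so [A k] is decided once [V k.+1] is
   frozen. *)
pose V k := (\bigcup_(i <- iota 0 k) W i)%fset.
have VS k : V k.+1 = (V k `|` W k)%fset.
  by rewrite /V -addn1 iotaD big_cat/= add0n big_seq1.
have Asub' m n : (m <= n)%N -> A n `<=` A m.
  move=> /subnK <-; elim: (n - m)%N => // k ih.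
  by rewrite addSn; apply: subset_trans ih.
have bA n : bounded_measurable (\1_(A n) : Om -> R).
  exact: bounded_measurable_indic.
have d1A n : depends_on (mem (W n)) (\1_(A n) : Om -> R).
  by move=> w w' ww'; rewrite !indicE; congr (_%:R); congr nat_of_bool;
    apply/idP/idP; rewrite !inE (dA n w w' ww').
pose alive k w := ~ (conditional_limit (V k) \1_(A n) w @[n --> \oo] --> (0 : R)).
have alive0 : alive 0%N point.
  rewrite /alive (_ : V 0%N = fset0); last by rewrite /V big_nil.
  by under eq_fun do rewrite conditional_limit_fset0.
(* If no prolongation were alive, the conditional limits would tend to 0 pointwise, hence so would
   their [P0] mean, which by the tower property is the conditional limit at stage [k]. *)
have aliveS k w : alive k w ->
    exists w', alive k.+1 (splice (predC (mem (V k))) w w').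
  move=> kw; apply: contrapT => /forallNP H; apply: kw.
  have VV : {subset V k <= V k.+1} by move=> s sV; rewrite VS inE sV.
  have [C fC] := conditional_limit_bound (V k.+1) 1.
  have [|||_] := @mean_dominated_cvg _ _ R P0
    (fun n w' => conditional_limit (V k.+1) \1_(A n)
      (splice (predC (mem (V k))) w w'))
    (fun=> 0) C.
  - by move=> n; have [[]] := conditional_limit_tower w VV (bA n) (d1A n).
  - apply: nearW => n w'; apply: fC (bA n) (d1A n) _ _ => v.
    by rewrite indicE; case: (_ \in _); rewrite ?normr1 ?normr0.
  - by move=> w'; apply: contrapT; exact: H.
  rewrite mean_cst; apply: cvg_trans; apply: near_eq_cvg; apply: nearW => n.
  by rewrite (conditional_limit_tower w VV (bA n) (d1A n)).2.
(* If [w] is not in [A k], the indicator of [A k] is a function of frozen sites vanishing at [w],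
   and it dominates that of [A n] for [n >= k]. *)
have alive_in k w : alive k.+1 w -> A k w.
  move=> kw; apply: contrapT => Akw; apply: kw; apply: cvg_near_cst.
  exists k => // n /= kn; apply/le_anti/andP; split.
    have <- : conditional_limit (V k.+1) (\1_(A k) : Om -> R) w = 0.
      apply: conditional_limit_eq0 => //.
        move=> v v' vv'; apply: d1A => s sW; apply: vv'.
        by rewrite /= VS inE; apply/orP; right.
      by rewrite indicE memNset.
    apply: le_conditional_limit (bA n) (d1A n) (bA k) (d1A k) _ => v.
    rewrite !indicE ler_nat; case: (boolP (v \in A n)) => //; rewrite inE => vn.
    by rewrite mem_set//; exact: Asub' kn _ vn.
  have d0 : depends_on (mem (V k.+1)) (fun _ : Om => 0 : R) by [].
  have b0 : bounded_measurable (fun _ : Om => 0 : R) by exact: bounded_measurable_cst.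
  have <- : conditional_limit (V k.+1) (fun=> 0) w = 0.
    exact: conditional_limit_eq0.
  by apply: le_conditional_limit b0 d0 (bA n) (d1A n) _ => v.
pose X := {x : nat * Om | alive x.1 x.2}.
pose next (x y : X) := (sval y).1 = (sval x).1.+1 /\
  exists w', (sval y).2 = splice (predC (mem (V (sval x).1))) (sval x).2 w'.
have nextP (x : X) : {y | next x y}.
  case: x => -[k w] kw; have /cid[w' kw'] := aliveS k w kw.
  exists (exist (fun x => alive x.1 x.2) (k.+1, _) kw').
  by split=> //; exists w'.
have [F [F0 FS]] := dependent_choice nextP
  (exist (fun x => alive x.1 x.2) (0%N, point) alive0).
have F1 k : (sval (F k)).1 = k.
  by elim: k => [|k ih]; [rewrite F0|rewrite (FS k).1 ih].
pose v k := (sval (F k)).2.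
have alive_v k : alive k (v k) by have := proj2_sig (F k); rewrite F1.
have vS k s : s \in V k -> v k.+1 s = v k s.
  move=> sV; rewrite {1}/v; have [_ [w' ->]] := FS k.
  by rewrite F1 /splice !inE/= sV.
have v_stable k n s : s \in V k -> (k <= n)%N -> s \in V n /\ v n s = v k s.
  move=> sV /subnK <-; elim: (n - k)%N => // m [ihV ihv].
  by rewrite addSn vS//; split=> //; rewrite VS inE ihV.
(* Frozen values never change again, so they glue to one configuration; sites that are never frozen
   get the default 0. *)
pose w s : R := xget 0 [set x | exists2 k, s \in V k & x = v k s].
have wE k s : s \in V k -> w s = v k s.
  move=> sV; rewrite /w; case: xgetP => [_ -> [k' sV' ->]|/(_ (v k s))/= []].
    have [_ <-] := v_stable _ (maxn k k') s sV (leq_maxl _ _).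
    by have [_ <-] := v_stable _ (maxn k k') s sV' (leq_maxr _ _).
  by exists k.
suff : (\bigcap_n A n)%classic w by rewrite A0.
move=> n _; have E : A n w = A n (v n.+1).
  by apply: dA => s sW; apply: wE; rewrite VS inE; apply/orP; right.
have H := alive_in n (v n.+1) (alive_v n.+1).
exact: (eq_ind_r (fun X : Prop => X) H E).
Qed.

(** * The limit content on local events *)

Lemma P_gibbs N (A : set Om) : P_ r P0 Phi N A = gibbs N \1_A.
Proof. by rewrite /P_ /expect0 unlock. Qed.

Definition gibbs_limit (A : set Om) : R := limn (gibbs ^~ (\1_A : Om -> R)).

Lemma gibbs_indic_cvg A : local_event A -> cvgn (gibbs ^~ (\1_A : Om -> R)).
Proof.
move=> [mA [Q dA]]; apply: (gibbs_cvg (W := Q)).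
  exact: bounded_measurable_indic.
move=> w w' ww'; rewrite !indicE; congr (_%:R); congr nat_of_bool.
by apply/idP/idP; rewrite !inE (dA w w' ww').
Qed.

Lemma gibbs_limit_ge0 A : local_event A -> 0 <= gibbs_limit A.
Proof.
move=> lA; apply: limr_ge; first exact: gibbs_indic_cvg.
apply: nearW => N; suff /andP[] : 0 <= gibbs N (\1_A : Om -> R) <= 1 by [].
have [mA _] := lA; apply: gibbs_bounds; first exact: bounded_measurable_indic.
by move=> w; rewrite indicE; case: (_ \in _); rewrite ?lexx ler01.
Qed.

Lemma gibbs_limitT : gibbs_limit setT = 1.
Proof.
apply/cvg_lim; first exact: Rhausdorff.
apply: cvg_near_cst; apply: nearW => N; apply/le_anti; rewrite andbC.
apply: gibbs_bounds; first exact: bounded_measurable_indic.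
by move=> w; rewrite indicT lexx.
Qed.

Lemma gibbs_limitU A B : local_event A -> local_event B -> A `&` B = set0 ->
  gibbs_limit (A `|` B) = gibbs_limit A + gibbs_limit B.
Proof.
move=> lA lB AB; apply/cvg_lim; first exact: Rhausdorff.
rewrite [X in X @ _](_ : _ = fun N =>
    gibbs N (\1_A : Om -> R) + gibbs N (\1_B : Om -> R)).
  exact: cvgD (gibbs_indic_cvg lA) (gibbs_indic_cvg lB).
apply/funext => N.
have beU := bounded_measurable_expR (bounded_measurable_U N).
have [[mA _] [mB _]] := (lA, lB).
have bA := bounded_measurableM (bounded_measurable_indic R mA) beU.
have bB := bounded_measurableM (bounded_measurable_indic R mB) beU.
rewrite /gibbs -mulrDl; apply: (congr1 (fun x => x / _)).
rewrite -(meanD P0 bA bB); apply: eq_mean => w.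
rewrite -mulrDl; congr (_ * _); rewrite !indicE in_setU -natrD; congr (_%:R).
case: (boolP (w \in A)); case: (boolP (w \in B)) => //; rewrite !inE => wB wA.
by move/seteqP: AB => [/(_ w (conj wA wB))].
Qed.

(* A measure must be nonnegative on all sets, also on the non-local ones, where
   [limn] may be a junk value: hence the absolute value. *)
Definition gibbs_premeasure (A : set (local_algebra R nu)) : \bar R :=
  `|gibbs_limit A|%:E.

Lemma gibbs_premeasureE A : local_event A ->
  gibbs_premeasure A = (gibbs_limit A)%:E.
Proof. by move=> lA; rewrite /gibbs_premeasure ger0_norm// gibbs_limit_ge0. Qed.

(** The remainders [B n], the union minus its first [n] members, are local and decrease to the empty
    set. Finite additivity turns the partial sums into the content of [S] minus that of [B n], which
    tends to 0. *)
Lemma gibbs_premeasure_sigma_additive : semi_sigma_additive gibbs_premeasure.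
Proof.
move=> F lF tF lUF; set S := (\bigcup_n F n)%classic in lUF *.
pose B n : set Om := [set w | S w /\ forall i, (i < n)%N -> ~ F i w].
have BS n : B n = F n `|` B n.+1.
  apply/seteqP; split=> w.
    move=> [Sw Fw]; case: (pselect (F n w)) => Fnw; first by left.
    right; split=> // i.
    by rewrite ltnS leq_eqVlt => /orP[/eqP->//|]; exact: Fw.
  move=> [Fnw|[Sw Fw]]; last by split=> // i i_n; apply: Fw; exact: ltnW.
  split=> [|i i_n Fiw]; first by exists n.
  have /trivIsetP/(_ i n I I) := tF; rewrite neq_ltn i_n => /(_ isT).
  by move/seteqP => [+ _] => /(_ w); apply.
have BSD n : B n.+1 = ~` (~` B n `|` F n).
  apply/seteqP; split=> w.
    move=> [Sw Fw] [|]; last exact: Fw.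
    by apply; split=> // i i_n; apply: Fw; exact: ltnW.
  move/not_orP => [/contrapT[Sw Fw] Fnw]; split=> // i.
  by rewrite ltnS leq_eqVlt => /orP[/eqP->//|]; exact: Fw.
have lB n : local_event (B n).
  elim: n => [|n ih].
    rewrite (_ : B 0%N = S); first exact: lUF.
    by apply/seteqP; split=> w; [case|split].
  rewrite BSD; apply/local_eventC/local_eventU; last exact: lF.
  exact: local_eventC.
have [W dB] := @choice _ _ (fun n (Q : {fset L}) => depends_on (mem Q) (B n))
  (fun n => (lB n).2).
have B0 : gibbs_limit (B n) @[n --> \oo] --> 0.
  apply: (gibbs_limit_continuous0 (fun n => (lB n).1) dB).
    by move=> n w Bw; rewrite BS; right.
  apply/seteqP; split=> // w Bw; have [[i _ Fiw] _] := Bw 0%N I.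
  by have [_ /(_ i)] := Bw i.+1 I; apply.
have sumE n : (\sum_(0 <= i < n) gibbs_premeasure (F i) =
    (gibbs_limit S - gibbs_limit (B n))%:E)%E.
  elim: n => [|n ih].
    rewrite big_geq// (_ : B 0%N = S) ?subrr//.
    by apply/seteqP; split=> w; [case|split].
  rewrite big_nat_recr//= ih gibbs_premeasureE; last exact: lF.
  rewrite -EFinD; congr EFin; rewrite [B n]BS gibbs_limitU.
  - by rewrite opprD addrA addrAC subrK.
  - exact: lF.
  - exact: lB.
  - by apply/seteqP; split=> // w [Fw [_ /(_ n)]]; apply.
under eq_fun do rewrite sumE.
rewrite gibbs_premeasureE//; apply: cvg_EFin; first exact: nearW.
rewrite -[X in _ --> X]subr0; apply: cvgB B0; exact: cvg_cst.
Qed.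

End Gibbs.

(* Uniqueness is equality on measurable sets: a library measure is a function on
   all subsets, with unconstrained values on the non-measurable ones. *)
Theorem corollary3p16 (R : realType) (nu : nat) (nu_ge1 : (1 <= nu)%N)
    (P : lattice nu -> probability (measurableTypeR R) R)
    (P0 : probability (Omega R nu) R) (P0_prod : is_product_probability P P0)
    (r : R) (r_ge1 : 1 <= r)
    (lambda : R) (lambda_ge0 : 0 <= lambda)
    (Phi : {fset lattice nu} -> Omega R nu -> R)
    (Phi_meas : forall B, frakB r B -> Sigma_measurable B (Phi B))
    (Phi_bound : forall B, frakB r B -> forall w, `|Phi B w| <= lambda)
    (lambda_le : lambda <= lambda0 nu r) :
  (forall (Q : {fset lattice nu}) (A : set (Omega R nu)),
     Sigma_ Q A -> cvgn (fun N => P_ r P0 Phi N A)) /\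
  exists Plambda : probability (Omega R nu) R,
    extends_P_lim r P0 Phi Plambda /\
    forall P' : probability (Omega R nu) R, extends_P_lim r P0 Phi P' ->
      forall A : set (Omega R nu), measurable A -> P' A = Plambda A.
Proof.
have infl := influence_le nu_ge1 r_ge1 lambda_ge0 lambda_le.
have P_E A : (fun N => P_ r P0 Phi N A) = gibbs P0 r Phi ^~ \1_A.
  by apply/funext => N; exact: P_gibbs.
split=> [Q A QA|].
  rewrite P_E; apply: (gibbs_indic_cvg P0_prod Phi_meas Phi_bound infl lambda_ge0).
  exact: Sigma_local_event QA.
have := @premeasure_extension R nu (gibbs_premeasure P0 r Phi).
have lT : local_event [set: Omega R nu].
  by rewrite -setC0; apply: local_eventC; exact: local_event0.
have premE := gibbs_premeasureE P0_prod Phi_meas Phi_bound infl lambda_ge0.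
case.
- rewrite premE; last exact: local_event0.
  (* Additivity for two empty events forces the value 0 on the empty set. *)
  have := gibbs_limitU P0_prod Phi_meas Phi_bound infl lambda_ge0
    (@local_event0 R nu) (@local_event0 R nu) (setI0 _).
  rewrite setU0 -[X in X = _]addr0 => /addrI <-//.
- by move=> A; rewrite lee_fin.
- exact: (gibbs_premeasure_sigma_additive P0_prod Phi_meas Phi_bound infl lambda_ge0).
- by rewrite premE// (gibbs_limitT P0 Phi_meas Phi_bound).
move=> Plambda PE; have extP : extends_P_lim r P0 Phi Plambda.
  move=> Q A QA; rewrite PE; last exact: Sigma_local_event QA.
  rewrite premE; last exact: Sigma_local_event QA.
  by rewrite /P_lim P_E.
exists Plambda; split=> // P' extP' A.
apply: measure_eq_cylinders => [|_ [[B F] /= mF <-]].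
  by rewrite (le_lt_trans (probability_le1 _ _)) ?ltry.
by rewrite (extP' B) ?(extP B)//; exact: Sigma_cylinder.
Qed.
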